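(* Over $\mathsf{RCA}_0$ the following are equivalent: (i) $\mathsf{WKL}_0$; (ii) every partial order not containing $\mathbf{2}\oplus\mathbf{2}$ is a 1-1 interval order; (iii) every interval order is a 1-1 interval order; (iv) every 1-1 interval order is a distinguishing interval order; (v) every 1-1 interval order is a closed interval order.
   Context: $\mathsf{RCA}_0$ is the base subsystem of second-order arithmetic ($\Delta^0_1$ comprehension, $\Sigma^0_1$ induction); $\mathsf{WKL}_0$ is $\mathsf{RCA}_0$ plus Weak König's Lemma (every infinite tree of finite $0$-$1$ sequences has an infinite path). A partial order $\mathbf{P}=(P,\leq_P)$ is a set $P\subseteq\mathbb{N}$ with a reflexive, transitive, antisymmetric relation; a linear order has any two elements comparable; $p<_P q$ means $p\leq_P q$, $p\ne q$. $\mathbf{P}$ is an interval order if there are a linear order $\mathbf{L}=(L,\leq_L)$ and $F\subseteq P\times L$ such that, with $F(p)=\{x:(p,x)\in F\}$: (i1) each $F(p)$ is nonempty and convex in $\mathbf{L}$; (i2) $p<_P q$ iff $x<_L y$ for all $x\in F(p),y\in F(q)$; a 1-1 interval order if moreover (i3) $F(p)\ne F(q)$ whenever $p\ne q$. $\mathbf{P}$ is a closed interval order if there are a linear order $\mathbf{L}$ and $f_0,f_1:P\to L$ with (c1) $f_0(p)\leq_L f_1(p)$ and (c2) $p<_P q$ iff $f_1(p)<_L f_0(q)$; a distinguishing interval order if moreover (c4) $f_i(p)\ne f_j(q)$ whenever $p\ne q$ or $i\ne j$. $\mathbf{P}$ does not contain $\mathbf{2}\oplus\mathbf{2}$ if for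 all $p_0,q_0,p_1,q_1\in P$, $p_0<_P q_0$ and $p_1<_P q_1$ imply $p_0\leq_P q_1$ or $p_1\leq_P q_0$. *)

(* Defs.v *)
Set Implicit Arguments.

(** The language is two-sorted and first-order: the set sort of a structure is
    an arbitrary nonempty domain, not the full powerset of the number sort.
    "Over T, phi and psi are equivalent" is read as: every structure satisfying
    T satisfies phi <-> psi. *)

Record L2_structure : Type := {
  num : Type;
  set : Type;
  set_inhabited : inhabited set;
  zero : num;
  one : num;
  plus : num -> num -> num;
  times : num -> num -> num;
  less : num -> num -> Prop;
  mem : num -> set -> Prop
}.

Arguments zero {_}.
Arguments one {_}.
Arguments plus {_} _ _.
Arguments times {_} _ _.
Arguments less {_} _ _.
Arguments mem {_} _ _.

Declare Scope L2_scope.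
Delimit Scope L2_scope with L2.
Bind Scope L2_scope with num.
Notation "0" := zero : L2_scope.
Notation "1" := one : L2_scope.
Notation "x + y" := (plus x y) : L2_scope.
Notation "x * y" := (times x y) : L2_scope.
Notation "x < y" := (less x y) : L2_scope.
Notation "x '\in' X" := (mem x X) (at level 70, no associativity) : L2_scope.
Local Open Scope L2_scope.

(** Formulas with bounded quantifiers only.  Number variables are de Bruijn
    indices; set variables are never bound and are named by naturals.  The
    bounding term of a quantifier lives outside its scope. *)

Inductive term : Type :=
| tvar (n : nat)
| tzero
| tone
| tplus (s t : term)
| ttimes (s t : term).

Inductive bformula : Type :=
| b_eq (s t : term)
| b_less (s t : term)
| b_mem (t : term) (X : nat)
| b_not (f : bformula)
| b_and (f g : bformula)
| b_or (f g : bformula)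
| b_imp (f g : bformula)
| b_all (t : term) (f : bformula)
| b_ex (t : term) (f : bformula).

Section Semantics.
Variable M : L2_structure.

Definition scons (x : num M) (e : nat -> num M) (n : nat) : num M :=
  match n with O => x | S n' => e n' end.

Fixpoint eval (e : nat -> num M) (t : term) : num M :=
  match t with
  | tvar n => e n
  | tzero => 0
  | tone => 1
  | tplus s t => eval e s + eval e t
  | ttimes s t => eval e s * eval e t
  end.

Fixpoint bsat (E : nat -> set M) (e : nat -> num M) (f : bformula) : Prop :=
  match f with
  | b_eq s t => eval e s = eval e t
  | b_less s t => eval e s < eval e t
  | b_mem t X => eval e t \in E X
  | b_not f => ~ bsat E e f
  | b_and f g => bsat E e f /\ bsat E e g
  | b_or f g => bsat E e f \/ bsat E e g
  | b_imp f g => bsat E e f -> bsat E e g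
  | b_all t f => forall x, x < eval e t -> bsat E (scons x e) f
  | b_ex t f => exists x, x < eval e t /\ bsat E (scons x e) f
  end.

(** Satisfaction at [n] of the Sigma^0_1 formula "exists k, f(k, n, params)" and
    of the Pi^0_1 formula "forall k, f(k, n, params)", where [E] and [e] assign
    the set and number parameters. *)

Definition sat_Sigma1 (f : bformula) (E : nat -> set M) (e : nat -> num M)
    (n : num M) : Prop :=
  exists k, bsat E (scons k (scons n e)) f.

Definition sat_Pi1 (f : bformula) (E : nat -> set M) (e : nat -> num M)
    (n : num M) : Prop :=
  forall k, bsat E (scons k (scons n e)) f.

Record basic_axioms : Prop := {
  succ_neq_zero : forall n : num M, n + 1 <> 0;
  succ_inj : forall m n : num M, m + 1 = n + 1 -> m = n;
  plus_zero : forall m : num M, m + 0 = m;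
  plus_succ : forall m n : num M, m + (n + 1) = (m + n) + 1;
  times_zero : forall m : num M, m * 0 = 0;
  times_succ : forall m n : num M, m * (n + 1) = m * n + m;
  not_less_zero : forall m : num M, ~ m < 0;
  less_succ : forall m n : num M, m < n + 1 <-> m < n \/ m = n
}.

Definition Sigma1_induction : Prop :=
  forall f E e,
    sat_Sigma1 f E e 0 ->
    (forall n, sat_Sigma1 f E e n -> sat_Sigma1 f E e (n + 1)) ->
    forall n, sat_Sigma1 f E e n.

Definition Delta1_comprehension : Prop :=
  forall f g E e,
    (forall n, sat_Sigma1 f E e n <-> sat_Pi1 g E e n) ->
    exists X : set M, forall n, n \in X <-> sat_Sigma1 f E e n.

Record RCA0 : Prop := {
  RCA0_basic : basic_axioms;
  RCA0_induction : Sigma1_induction;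
  RCA0_comprehension : Delta1_comprehension
}.

(** Pairs, finite sets and finite sequences are coded inside a structure as in
    Simpson's book: (i, j) is coded by (i + j)^2 + i. *)

Definition pair (i j : num M) : num M := (i + j) * (i + j) + i.

Definition subset_prod (R P Q : set M) : Prop :=
  forall z, z \in R -> exists p q, p \in P /\ q \in Q /\ z = pair p q.

Definition holds (R : set M) (p q : num M) : Prop := pair p q \in R.

Definition strict (R : set M) (p q : num M) : Prop := holds R p q /\ p <> q.

(** [f] is (the graph of) a function from [P] to [Q]; [holds f p x] then means
    f(p) = x. *)
Definition function (f P Q : set M) : Prop :=
  subset_prod f P Q /\
  (forall p, p \in P -> exists x, holds f p x) /\
  (forall p x y, holds f p x -> holds f p y -> x = y).

(** [x] belongs to the finite set given by the triple (k, (m, n)): x < k and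
    m (x + 1) + 1 divides n. *)
Definition triple_mem (k m n x : num M) : Prop :=
  x < k /\ exists q, n = (m * (x + 1) + 1) * q.

Definition code_mem (s x : num M) : Prop :=
  exists k m n, s = pair k (pair m n) /\ triple_mem k m n x.

(** A finite set is coded by the least (k, (m, n)) defining it. *)
Definition set_code (s : num M) : Prop :=
  (exists k m n, s = pair k (pair m n)) /\
  (forall k m n, pair k (pair m n) < s ->
     ~ (forall x, triple_mem k m n x <-> code_mem s x)).

(** [s] codes a finite 0-1 sequence of length [l], as the finite set of pairs
    (i, s(i)) with i < l. *)
Definition binary_seq (s l : num M) : Prop :=
  set_code s /\
  (forall z, code_mem s z ->
     exists i b, i < l /\ (b = 0 \/ b = 1) /\ z = pair i b) /\
  (forall i, i < l -> exists b, code_mem s (pair i b)) /\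
  (forall i b c, code_mem s (pair i b) -> code_mem s (pair i c) -> b = c).

Definition binary_tree (T : set M) : Prop :=
  (forall s, s \in T -> exists l, binary_seq s l) /\
  (forall s t l, s \in T -> binary_seq t l ->
     (forall x, code_mem t x -> code_mem s x) -> t \in T).

Definition infinite (X : set M) : Prop :=
  forall k, exists x, x \in X /\ ~ x < k.

(** [g] is a function from all numbers to {0, 1} each of whose finite initial
    segments g[n] is in [T]. *)
Definition path (T g : set M) : Prop :=
  (forall z, z \in g -> exists i b, (b = 0 \/ b = 1) /\ z = pair i b) /\
  (forall i, exists b, holds g i b) /\
  (forall i b c, holds g i b -> holds g i c -> b = c) /\
  (forall n, exists s, s \in T /\ binary_seq s n /\
     forall i b, i < n -> (code_mem s (pair i b) <-> holds g i b)).

Definition weak_Konig_lemma : Prop :=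
  forall T, binary_tree T -> infinite T -> exists g, path T g.

Definition WKL0 : Prop := RCA0 /\ weak_Konig_lemma.

Record partial_order (P R : set M) : Prop := {
  po_sub : subset_prod R P P;
  po_refl : forall p, p \in P -> holds R p p;
  po_trans : forall p q r, p \in P -> q \in P -> r \in P ->
    holds R p q -> holds R q r -> holds R p r;
  po_antisym : forall p q, p \in P -> q \in P ->
    holds R p q -> holds R q p -> p = q
}.

Definition linear_order (L R : set M) : Prop :=
  partial_order L R /\
  forall x y, x \in L -> y \in L -> holds R x y \/ holds R y x.

Definition no_2plus2 (P R : set M) : Prop :=
  forall p0 q0 p1 q1, p0 \in P -> q0 \in P -> p1 \in P -> q1 \in P ->
    strict R p0 q0 -> strict R p1 q1 -> holds R p0 q1 \/ holds R p1 q0.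

(** In [interval_rep], F(p) = {x : (p, x) in F}. *)

Record interval_rep (P R L RL F : set M) : Prop := {
  ir_linear : linear_order L RL;
  ir_sub : subset_prod F P L;
  ir_nonempty : forall p, p \in P -> exists x, holds F p x;
  ir_convex : forall p x y z, p \in P -> x \in L -> y \in L -> z \in L ->
    holds F p x -> holds F p z -> holds RL x y -> holds RL y z -> holds F p y;
  ir_order : forall p q, p \in P -> q \in P ->
    (strict R p q <-> forall x y, holds F p x -> holds F q y -> strict RL x y)
}.

Definition interval_order (P R : set M) : Prop :=
  partial_order P R /\ exists L RL F, interval_rep P R L RL F.

Definition one_one_interval_order (P R : set M) : Prop :=
  partial_order P R /\
  exists L RL F, interval_rep P R L RL F /\
    forall p q, p \in P -> q \in P -> p <> q ->
      ~ (forall x, holds F p x <-> holds F q x).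

Record closed_rep (P R L RL f0 f1 : set M) : Prop := {
  cr_linear : linear_order L RL;
  cr_fun0 : function f0 P L;
  cr_fun1 : function f1 P L;
  cr_le : forall p a b, p \in P -> holds f0 p a -> holds f1 p b -> holds RL a b;
  cr_order : forall p q b a, p \in P -> q \in P -> holds f1 p b -> holds f0 q a ->
    (strict R p q <-> strict RL b a)
}.

Definition closed_interval_order (P R : set M) : Prop :=
  partial_order P R /\ exists L RL f0 f1, closed_rep P R L RL f0 f1.

Definition distinguishing_interval_order (P R : set M) : Prop :=
  partial_order P R /\
  exists L RL f0 f1, closed_rep P R L RL f0 f1 /\
    forall (i j : bool) p q x y, p \in P -> q \in P ->
      holds (if i then f1 else f0) p x -> holds (if j then f1 else f0) q y ->
      p <> q \/ i <> j -> x <> y.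

End Semantics.

(* Main.v *)
(** Each p is to be represented by an interval [a p, b p].  The interval order
    prescribes b p < a q when p < q and a q <= b p otherwise; absence of 2 + 2
    says that this relation between left and right endpoints has no cycle.  For
    the elements below n a linear extension can be written down with bounded
    quantifiers, ordering left endpoints by the sets of elements below them and
    right endpoints by the sets of elements above them, so weak König's lemma
    yields a linear extension for all elements at once; it gives a representation
    which is both distinguishing and 1-1.

    Conversely, both weak principles separate two disjoint Sigma^0_1 sets A and
    B, and this suffices: at a node of an infinite binary tree, separate the
    nodes whose right subtree is seen to die first from those whose left subtree
    is, and follow the choices.  For the separation take a pair of incomparable
    elements p_n, q_n for each n.  When n enters A, put a new element above p_n
    and overlapping q_n, and one below p_n and overlapping q_n; when n enters B,
    exchange p_n and q_n.  If n is in A then F(p_n) is contained in F(q_n), and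
    conversely for B, so a point of the symmetric difference decides n; in a 1-1
    representation it can be searched for.  If only the new elements above are
    used, a 1-1 representation exists outright, by extending F(p_n) to the left,
    and in a closed representation the order of the right endpoints of p_n and
    q_n decides n. *)

From Stdlib Require Import Arith Lia Classical Ring.
Require Import Defs.

Set Implicit Arguments.
Local Open Scope L2_scope.

(** * Definability *)

(** Only Sigma1 induction and Delta1 comprehension are available, so every set and every induction
    needs a definition with explicit bounds. Whether q has a predecessor that p lacks is an
    unbounded question, so the order of the left endpoints need not exist as a set. Cut off at n it
    is decidable, but a tie broken by number may be overturned at a larger n; the limit of the
    approximations need not be a set either, and the choice is left to compactness. For the
    converse, Sigma1 sets are given by stages, as sets of pairs (n, s). Two gadgets are used because
    1-1 is a weak demand: with new elements above only, F(p_n) and F(q_n) can be told apart at the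
    left end, where nothing about n is recorded, so both ends have to be blocked. In (v) a 1-1
    representation has to be given in advance, without deciding whether n enters A or B, and the
    free left end makes that possible; a closed representation still has to order the right
    endpoints correctly. *)

Definition interleave (A : Type) (u v : nat -> A) (n : nat) : A :=
  if Nat.even n then u (Nat.div2 n) else v (Nat.div2 n).

Lemma interleave_even (A : Type) (u v : nat -> A) n :
  interleave u v (2 * n) = u n.
Proof.
  unfold interleave. rewrite Nat.div2_double.
  now replace (Nat.even (2 * n)) with true by (symmetry; apply Nat.even_spec; now exists n).
Qed.

Lemma interleave_odd (A : Type) (u v : nat -> A) n :
  interleave u v (S (2 * n)) = v n.
Proof.
  unfold interleave. rewrite Nat.div2_succ_double, Nat.even_succ.
  now replace (Nat.odd (2 * n)) with false by
    (symmetry; rewrite <- Nat.negb_even; now replace (Nat.even (2 * n)) with true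
       by (symmetry; apply Nat.even_spec; now exists n)).
Qed.

Definition up (r : nat -> nat) (n : nat) : nat :=
  match n with O => O | S n' => S (r n') end.

Fixpoint rename_term (r : nat -> nat) (t : term) : term :=
  match t with
  | tvar n => tvar (r n)
  | tzero => tzero
  | tone => tone
  | tplus s t => tplus (rename_term r s) (rename_term r t)
  | ttimes s t => ttimes (rename_term r s) (rename_term r t)
  end.

Fixpoint rename (r q : nat -> nat) (f : bformula) : bformula :=
  match f with
  | b_eq s t => b_eq (rename_term r s) (rename_term r t)
  | b_less s t => b_less (rename_term r s) (rename_term r t)
  | b_mem t X => b_mem (rename_term r t) (q X)
  | b_not f => b_not (rename r q f)
  | b_and f g => b_and (rename r q f) (rename r q g)
  | b_or f g => b_or (rename r q f) (rename r q g)
  | b_imp f g => b_imp (rename r q f) (rename r q g)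
  | b_all t f => b_all (rename_term r t) (rename (up r) q f)
  | b_ex t f => b_ex (rename_term r t) (rename (up r) q f)
  end.

Section Definability.
Variable M : L2_structure.

Local Notation env := (nat -> num M).

Lemma eval_rename r t (e e' : env) :
  (forall n, e' (r n) = e n) -> eval M e' (rename_term r t) = eval M e t.
Proof. intros H; induction t; simpl; congruence. Qed.

Lemma bsat_rename f : forall r q (E E' : nat -> set M) (e e' : env),
  (forall n, e' (r n) = e n) -> (forall n, E' (q n) = E n) ->
  bsat M E' e' (rename r q f) <-> bsat M E e f.
Proof.
  induction f as [s t|s t|t X|f IH|f IHf g IHg|f IHf g IHg|f IHf g IHg|t f IH|t f IH];
    intros r q E E' e e' Hr Hq; simpl;
    rewrite ?(@eval_rename r _ e e' Hr), ?Hq;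
    try rewrite (IH r q E E' e e'); try rewrite (IHf r q E E' e e');
    try rewrite (IHg r q E E' e e'); try tauto.
  - split; intros H x Hx; apply (IH (up r) q E E' (scons M x e) (scons M x e'));
      try apply H; auto; now intros [|n]; simpl.
  - split; intros (x & Hx & H); exists x; (split; [easy|]);
      apply (IH (up r) q E E' (scons M x e) (scons M x e')); auto; now intros [|n]; simpl.
Qed.

(** The even-numbered variables are the arguments, the odd-numbered ones hold
    parameters from the structure. *)
Definition polynomial (t : env -> num M) : Prop :=
  exists u c, forall e, eval M (interleave e c) u = t e.

(** The formula and its parameters are hidden, so that definability is proved by closure lemmas
    without ever displaying a formula. *)
Definition Delta0 (P : env -> Prop) : Prop :=
  exists f E c, forall e, bsat M E (interleave e c) f <-> P e.

(** Two formulas with unrelated parameters are brought over one parameter list: the arguments keep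
    their places, and the two lists are interleaved once more within the odd places. *)
Lemma interleave_renaming : exists rl rr : nat -> nat,
  forall (A : Type) (e c c' : nat -> A) n,
    interleave e (interleave c c') (rl n) = interleave e c n /\
    interleave e (interleave c c') (rr n) = interleave e c' n.
Proof.
  exists (fun n => if Nat.even n then n else S (2 * (2 * Nat.div2 n))).
  exists (fun n => if Nat.even n then n else S (2 * (S (2 * Nat.div2 n)))).
  intros A e c c' n. cbv beta.
  destruct (Nat.even n) eqn:Hn.
  - unfold interleave. now rewrite !Hn.
  - rewrite !interleave_odd, interleave_even.
    unfold interleave. now rewrite Hn.
Qed.

Lemma polynomial_var n : polynomial (fun e => e n).
Proof.
  exists (tvar (2 * n)), (fun _ => 0). intros e; simpl eval.
  apply interleave_even.
Qed.

Lemma polynomial_const c : polynomial (fun _ => c).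
Proof.
  exists (tvar 1), (fun _ => c). intros e. exact (interleave_odd e (fun _ => c) O).
Qed.

Lemma polynomial_shift t : polynomial t -> polynomial (fun e => t (fun n => e (S n))).
Proof.
  intros (u & c & Hu).
  exists (rename_term (fun n => if Nat.even n then S (S n) else n) u), c.
  intros e. rewrite <- Hu. apply eval_rename.
  intros n. unfold interleave. destruct (Nat.even n) eqn:Hn; [|now rewrite Hn].
  simpl Nat.even. now rewrite Hn.
Qed.

Lemma two_polynomials s t : polynomial s -> polynomial t ->
  exists u v c, (forall e, eval M (interleave e c) u = s e) /\
    (forall e, eval M (interleave e c) v = t e).
Proof.
  intros (u & c & Hu) (v & c' & Hv).
  destruct interleave_renaming as (rl & rr & Hr).
  exists (rename_term rl u), (rename_term rr v), (interleave c c').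
  split; intros e; [rewrite <- Hu | rewrite <- Hv];
    apply eval_rename; intros n; apply (Hr _ e c c' n).
Qed.

Lemma polynomial_plus s t : polynomial s -> polynomial t ->
  polynomial (fun e => s e + t e).
Proof.
  intros Hs Ht. destruct (two_polynomials Hs Ht) as (u & v & c & Hu & Hv).
  exists (tplus u v), c. intros e; simpl. now rewrite Hu, Hv.
Qed.

Lemma polynomial_times s t : polynomial s -> polynomial t ->
  polynomial (fun e => s e * t e).
Proof.
  intros Hs Ht. destruct (two_polynomials Hs Ht) as (u & v & c & Hu & Hv).
  exists (ttimes u v), c. intros e; simpl. now rewrite Hu, Hv.
Qed.

Lemma polynomial_pair s t : polynomial s -> polynomial t ->
  polynomial (fun e => pair M (s e) (t e)).
Proof.
  intros Hs Ht. unfold pair.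
  repeat (apply polynomial_plus || apply polynomial_times); assumption.
Qed.

Lemma Delta0_ext (P Q : env -> Prop) :
  (forall e, P e <-> Q e) -> Delta0 P -> Delta0 Q.
Proof.
  intros H (f & E & c & Hf). exists f, E, c. intros e. now rewrite Hf.
Qed.

Lemma Delta0_rename P (r : nat -> nat) (s : env -> env) : Delta0 P ->
  (forall e n, s e n = e (r n)) -> Delta0 (fun e => P (s e)).
Proof.
  intros (f & E & c & Hf) Hs.
  exists (rename (fun n => if Nat.even n then 2 * r (Nat.div2 n) else n)%nat (fun n => n) f),
    E, c.
  intros e. rewrite <- Hf. apply bsat_rename; [|easy].
  intros n. unfold interleave at 2. destruct (Nat.even n) eqn:Hn.
  - now rewrite interleave_even.
  - unfold interleave. now rewrite Hn.
Qed.

Lemma Delta0_eq s t : polynomial s -> polynomial t -> Delta0 (fun e => s e = t e).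
Proof.
  intros Hs Ht. destruct (two_polynomials Hs Ht) as (u & v & c & Hu & Hv).
  destruct (set_inhabited M) as [X].
  exists (b_eq u v), (fun _ => X), c. intros e; simpl. now rewrite Hu, Hv.
Qed.

Lemma Delta0_less s t : polynomial s -> polynomial t -> Delta0 (fun e => s e < t e).
Proof.
  intros Hs Ht. destruct (two_polynomials Hs Ht) as (u & v & c & Hu & Hv).
  destruct (set_inhabited M) as [X].
  exists (b_less u v), (fun _ => X), c. intros e; simpl. now rewrite Hu, Hv.
Qed.

Lemma Delta0_mem t X : polynomial t -> Delta0 (fun e => t e \in X).
Proof.
  intros (u & c & Hu).
  exists (b_mem u O), (fun _ => X), c. intros e; simpl. now rewrite Hu.
Qed.

Lemma Delta0_not P : Delta0 P -> Delta0 (fun e => ~ P e).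
Proof.
  intros (f & E & c & Hf). exists (b_not f), E, c. intros e; simpl.
  now rewrite Hf.
Qed.

Lemma two_Delta0 P Q : Delta0 P -> Delta0 Q ->
  exists f g E c, (forall e, bsat M E (interleave e c) f <-> P e) /\
    (forall e, bsat M E (interleave e c) g <-> Q e).
Proof.
  intros (f & E & c & Hf) (g & E' & c' & Hg).
  destruct interleave_renaming as (rl & rr & Hr).
  exists (rename rl (fun n => 2 * n)%nat f), (rename rr (fun n => S (2 * n)) g),
    (interleave E E'), (interleave c c').
  split; intros e; [rewrite <- Hf | rewrite <- Hg];
    (apply bsat_rename; intros n; [apply (Hr _ e c c' n)|]).
  - apply interleave_even.
  - apply interleave_odd.
Qed.

Lemma Delta0_and P Q : Delta0 P -> Delta0 Q -> Delta0 (fun e => P e /\ Q e).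
Proof.
  intros HP HQ. destruct (two_Delta0 HP HQ) as (f & g & E & c & Hf & Hg).
  exists (b_and f g), E, c. intros e; simpl. now rewrite Hf, Hg.
Qed.

Lemma Delta0_or P Q : Delta0 P -> Delta0 Q -> Delta0 (fun e => P e \/ Q e).
Proof.
  intros HP HQ. destruct (two_Delta0 HP HQ) as (f & g & E & c & Hf & Hg).
  exists (b_or f g), E, c. intros e; simpl. now rewrite Hf, Hg.
Qed.

Lemma Delta0_imp P Q : Delta0 P -> Delta0 Q -> Delta0 (fun e => P e -> Q e).
Proof.
  intros HP HQ. destruct (two_Delta0 HP HQ) as (f & g & E & c & Hf & Hg).
  exists (b_imp f g), E, c. intros e; simpl. now rewrite Hf, Hg.
Qed.

Lemma Delta0_iff P Q : Delta0 P -> Delta0 Q -> Delta0 (fun e => P e <-> Q e).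
Proof. intros HP HQ. unfold iff. apply Delta0_and; now apply Delta0_imp. Qed.

Lemma Delta0_ex t (P : num M -> env -> Prop) : polynomial t ->
  Delta0 (fun e => P (e O) (fun n => e (S n))) ->
  Delta0 (fun e => exists x, x < t e /\ P x e).
Proof.
  intros (u & c & Hu) (f & E & c' & Hf).
  destruct interleave_renaming as (rl & rr & Hr).
  (* In [f] the bound variable is the first argument and takes position 0 of the interleaving; under
     the quantifier it stands in front of the interleaving of the rest. So [e k] moves from 2 k + 2
     to 2 k + 1, and the parameter k from 2 k + 1 to 2 k + 2. *)
  set (r := fun n => match n with O => O | _ =>
    if Nat.even n then S (2 * Nat.pred (Nat.div2 n)) else S (S (2 * Nat.div2 n)) end).
  exists (b_ex (rename_term rl u) (rename (fun n => up rr (r n)) (fun n => n) f)), E,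
    (interleave c c').
  intros e; simpl.
  rewrite (@eval_rename rl u (interleave e c)) by (intros n; apply (Hr _ e c c' n)).
  rewrite Hu.
  enough (H : forall x,
    bsat M E (scons M x (interleave e (interleave c c')))
      (rename (fun n => up rr (r n)) (fun n => n) f) <-> P x e).
  { split; intros (x & Hx & HP); exists x; split; auto; now apply H. }
  intros x.
  specialize (Hf (scons M x e)). simpl in Hf.
  change (bsat M E (interleave (scons M x e) c') f <-> P x e) in Hf.
  rewrite <- Hf. apply bsat_rename; [|easy]. intros n.
  transitivity (scons M x (interleave e c') (r n)).
  - destruct (r n); simpl; [easy|]. apply (Hr _ e c c').
  - unfold r. destruct n as [|n]; [easy|].
    destruct (Nat.even (S n)) eqn:Hn.
    + apply Nat.even_spec in Hn. destruct Hn as [[|k] Hk]; [discriminate|].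
      rewrite Hk, Nat.div2_double. simpl scons.
      replace (k + (k + 0))%nat with (2 * k)%nat by lia. rewrite (interleave_even e c').
      now rewrite (interleave_even (scons M x e) c' (S k)).
    + rewrite <- Nat.negb_odd in Hn. apply Bool.negb_false_iff, Nat.odd_spec in Hn.
      destruct Hn as [k Hk]. rewrite Hk, Nat.add_1_r, Nat.div2_succ_double.
      simpl scons. replace (S (k + (k + 0)))%nat with (S (2 * k)) by lia.
      now rewrite !interleave_odd.
Qed.

Lemma Delta0_all t (P : num M -> env -> Prop) : polynomial t ->
  Delta0 (fun e => P (e O) (fun n => e (S n))) ->
  Delta0 (fun e => forall x, x < t e -> P x e).
Proof.
  intros Ht HP.
  apply Delta0_ext with (P := fun e => ~ exists x, x < t e /\ ~ P x e).
  - intros e; split.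
    + intros H x Hx. apply NNPP. intros HN. apply H. now exists x.
    + intros H (x & Hx & HN). now apply HN, H.
  - apply Delta0_not. apply Delta0_ex with (P := fun x e => ~ P x e); [easy|].
    now apply Delta0_not.
Qed.

Definition Sigma1 (P : env -> Prop) : Prop :=
  exists Q : num M -> env -> Prop,
    Delta0 (fun e => Q (e O) (fun n => e (S n))) /\
    forall e, P e <-> exists k, Q k e.

(** The axioms expect the witness in variable 0, the number in variable 1 and the parameters after
    them. All arguments beyond the witness may be identified, since the predicates concerned depend
    on a single number. *)
Lemma two_variables_renaming : exists r : nat -> nat,
  forall f E c k n,
    bsat M E (scons M k (scons M n c)) (rename r (fun n => n) f) <->
    bsat M E (interleave (scons M k (fun _ => n)) c) f.
Proof.
  exists (fun n => match n with O => O | _ =>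
    if Nat.even n then 1%nat else S (S (Nat.div2 n)) end).
  intros f E c k n. apply bsat_rename; [|easy].
  intros [|m]; [easy|].
  unfold interleave.
  destruct (Nat.even (S m)) eqn:Hm; [|easy].
  now destruct m as [|m].
Qed.

Lemma Sigma1_induct (HM : RCA0 M) (P : num M -> Prop) :
  Sigma1 (fun e => P (e O)) ->
  P 0 -> (forall n, P n -> P (n + 1)) -> forall n, P n.
Proof.
  intros (Q & (f & E & c & Hf) & HQ).
  destruct two_variables_renaming as (r & Hr).
  assert (H : forall n, P n <-> sat_Sigma1 M (rename r (fun n => n) f) E c n).
  { intros n. rewrite (HQ (fun _ => n)). unfold sat_Sigma1.
    setoid_rewrite Hr. now setoid_rewrite Hf. }
  intros H0 HS n. apply H, (RCA0_induction HM).
  - now apply H.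
  - intros m Hm. apply H, HS, H, Hm.
Qed.

Lemma comprehension (HM : RCA0 M) (P : num M -> Prop) :
  Sigma1 (fun e => P (e O)) -> Sigma1 (fun e => ~ P (e O)) ->
  exists X, forall n, n \in X <-> P n.
Proof.
  intros (Q & HQ0 & HQ) (Q' & HQ0' & HQ').
  (* The axiom wants both formulas over the same parameters; the matrix of the Pi1 side is the
     negated matrix of the complement. *)
  destruct (two_Delta0 HQ0 (Delta0_not HQ0')) as (f & g & E & c & Hf & Hg).
  destruct two_variables_renaming as (r & Hr).
  assert (H : forall n, P n <-> sat_Sigma1 M (rename r (fun n => n) f) E c n).
  { intros n. rewrite (HQ (fun _ => n)). unfold sat_Sigma1.
    setoid_rewrite Hr. now setoid_rewrite Hf. }
  destruct (@RCA0_comprehension _ HM (rename r (fun n => n) f) (rename r (fun n => n) g) E c)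
    as (X & HX).
  - intros n. rewrite <- H. unfold sat_Pi1. setoid_rewrite Hr. setoid_rewrite Hg.
    pose proof (HQ' (fun _ => n)) as Hn. simpl in Hn |- *. split.
    + intros HP k Hk. apply Hn; [|easy]. now exists k.
    + intros HN. apply NNPP. intros HP. apply Hn in HP. destruct HP as (k & Hk).
      now apply (HN k).
  - exists X. intros n. rewrite HX. symmetry. apply H.
Qed.

Lemma Delta0_Sigma1 P : Delta0 P -> Sigma1 P.
Proof.
  intros HP. exists (fun _ => P). split.
  - now apply (Delta0_rename S (fun e n => e (S n)) HP).
  - intros e; split; [now exists 0 | now intros [_ H]].
Qed.

Lemma Sigma1_ext (P Q : env -> Prop) :
  (forall e, P e <-> Q e) -> Sigma1 P -> Sigma1 Q.
Proof.
  intros H (R & HR & HP). exists R. split; [easy|]. intros e. now rewrite <- H.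
Qed.

Lemma Sigma1_ex_Delta0 (P : num M -> env -> Prop) :
  Delta0 (fun e => P (e O) (fun n => e (S n))) -> Sigma1 (fun e => exists k, P k e).
Proof. intros HP. now exists P. Qed.

Lemma Delta0_comprehension (HM : RCA0 M) (P : num M -> Prop) :
  Delta0 (fun e => P (e O)) -> exists X, forall n, n \in X <-> P n.
Proof.
  intros HP. apply comprehension; [easy| |]; apply Delta0_Sigma1; [easy|].
  now apply Delta0_not.
Qed.

Lemma Delta0_induct (HM : RCA0 M) (P : num M -> Prop) :
  Delta0 (fun e => P (e O)) ->
  P 0 -> (forall n, P n -> P (n + 1)) -> forall n, P n.
Proof. intros HP. apply Sigma1_induct; [easy|]. now apply Delta0_Sigma1. Qed.

End Definability.

Ltac polynomial :=
  repeat first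
    [ assumption | apply polynomial_var | apply polynomial_const
    | apply polynomial_plus | apply polynomial_times | apply polynomial_pair ].

Create HintDb delta0.

(** Definability is read off the shape of the predicate; defined notions are resolved through the
    hint database, which grows as their bounded forms are established. *)
Ltac delta0 :=
  cbv beta;
  lazymatch goal with
  | |- Delta0 _ (fun e => _ = _) => apply Delta0_eq; polynomial
  | |- Delta0 _ (fun e => _ < _) => apply Delta0_less; polynomial
  | |- Delta0 _ (fun e => _ \in _) => apply Delta0_mem; polynomial
  | |- Delta0 _ (fun e => exists x, _) => apply Delta0_ex; [polynomial | delta0]
  | |- Delta0 _ (fun e => forall x, x < _ -> _) => apply Delta0_all; [polynomial | delta0]
  | |- Delta0 _ (fun e => _ /\ _) => apply Delta0_and; delta0
  | |- Delta0 _ (fun e => _ \/ _) => apply Delta0_or; delta0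
  | |- Delta0 _ (fun e => _ <-> _) => apply Delta0_iff; delta0
  | |- Delta0 _ (fun e => ~ _) => apply Delta0_not; delta0
  | |- Delta0 _ (fun e => _ -> _) => apply Delta0_imp; delta0
  | |- _ => auto with delta0
  end.

Ltac num_induct n :=
  revert n;
  match goal with HM : RCA0 _ |- forall n, @?P n =>
    apply (@Delta0_induct _ HM P); [delta0 | | intros n ?IH]; cbv beta end.

Ltac sigma_induct n :=
  revert n;
  match goal with HM : RCA0 _ |- forall n, @?P n =>
    apply (@Sigma1_induct _ HM P); cbv beta end.

(** * Arithmetic *)

Section Arithmetic.
Variable M : L2_structure.
Hypothesis HM : RCA0 M.

Let ax : basic_axioms M := RCA0_basic HM.

Lemma zero_plus (n : num M) : 0 + n = n.
Proof.
  num_induct n.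
  - apply (plus_zero ax).
  - now rewrite (plus_succ ax), IH.
Qed.

Lemma succ_plus (m n : num M) : (m + 1) + n = (m + n) + 1.
Proof.
  num_induct n.
  - now rewrite !(plus_zero ax).
  - now rewrite !(plus_succ ax), IH.
Qed.

Lemma plus_comm (m n : num M) : m + n = n + m.
Proof.
  num_induct n.
  - now rewrite (plus_zero ax), zero_plus.
  - now rewrite (plus_succ ax), succ_plus, IH.
Qed.

Lemma plus_assoc (l m n : num M) : l + (m + n) = (l + m) + n.
Proof.
  num_induct n.
  - now rewrite !(plus_zero ax).
  - now rewrite !(plus_succ ax), IH.
Qed.

Lemma zero_times (n : num M) : 0 * n = 0.
Proof.
  num_induct n.
  - apply (times_zero ax).
  - now rewrite (times_succ ax), IH, zero_plus.
Qed.

Lemma succ_times (m n : num M) : (m + 1) * n = m * n + n.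
Proof.
  num_induct n.
  - now rewrite !(times_zero ax), zero_plus.
  - rewrite !(times_succ ax), IH, !(plus_succ ax).
    f_equal. rewrite <- !plus_assoc. f_equal. apply plus_comm.
Qed.

Lemma times_comm (m n : num M) : m * n = n * m.
Proof.
  num_induct n.
  - now rewrite (times_zero ax), zero_times.
  - now rewrite (times_succ ax), succ_times, IH.
Qed.

Lemma times_plus_distr (l m n : num M) : (l + m) * n = l * n + m * n.
Proof.
  num_induct n.
  - now rewrite !(times_zero ax), zero_plus.
  - rewrite !(times_succ ax), IH, <- !plus_assoc. f_equal.
    now rewrite !plus_assoc, (plus_comm l).
Qed.

Lemma times_assoc (l m n : num M) : l * (m * n) = (l * m) * n.
Proof.
  num_induct n.
  - now rewrite !(times_zero ax).
  - now rewrite !(times_succ ax), (times_comm l (_ + _)), times_plus_distr,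
      <- IH, (times_comm l), (times_comm m l).
Qed.

Lemma one_times (n : num M) : 1 * n = n.
Proof.
  rewrite <- (zero_plus 1), succ_times, zero_times. apply zero_plus.
Qed.

Lemma num_semi_ring :
  semi_ring_theory (@zero M) one plus times eq.
Proof.
  split.
  - exact zero_plus.
  - exact plus_comm.
  - exact plus_assoc.
  - exact one_times.
  - exact zero_times.
  - exact times_comm.
  - exact times_assoc.
  - exact times_plus_distr.
Qed.

Add Ring num_ring : num_semi_ring.

Lemma plus_cancel (k m n : num M) : m + k = n + k -> m = n.
Proof.
  num_induct k.
  - now rewrite !(plus_zero ax).
  - rewrite !(plus_succ ax). intros H. apply IH, (succ_inj ax), H.
Qed.

Lemma zero_or_succ (n : num M) : n = 0 \/ exists m, n = m + 1.
Proof.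
  sigma_induct n.
  (* The predecessor comes with no bound here, so the quantifier is moved to the front and the
     induction is Sigma1. *)
  - apply (@Sigma1_ext _ (fun e => exists m, e O = 0 \/ e O = m + 1)).
    + intros e; split.
      * intros (m & [H | H]); [now left | right; now exists m].
      * intros [H | (m & H)]; [exists 0; now left | exists m; now right].
    + apply Sigma1_ex_Delta0. delta0.
  - now left.
  - intros n _. right. now exists n.
Qed.

Lemma less_iff (m n : num M) : m < n <-> exists d, n = m + d + 1.
Proof.
  split.
  - sigma_induct n.
    + apply (@Sigma1_ext _ (fun e => exists d, m < e O -> e O = m + d + 1)).
      * intros e; split; [intros (d & H) Hm; exists d; exact (H Hm)|].
        intros H. destruct (classic (m < e O)) as [Hm | Hm]; [|now exists 0].
        destruct (H Hm) as (d & Hd). now exists d.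
      * apply Sigma1_ex_Delta0. delta0.
    + intros H. now apply (not_less_zero ax) in H.
    + intros n IH H. apply (less_succ ax) in H. destruct H as [H | <-].
      * destruct (IH H) as (d & ->). exists (d + 1). ring.
      * exists 0. ring.
  - intros (d & ->). num_induct d.
    + apply (less_succ ax). right. ring.
    + apply (less_succ ax). left. now replace (m + (d + 1)) with (m + d + 1) by ring.
Qed.

Lemma less_intro (m n d : num M) : n = m + d + 1 -> m < n.
Proof. intros H. apply less_iff. now exists d. Qed.


Lemma less_irrefl (n : num M) : ~ n < n.
Proof.
  intros H. apply less_iff in H. destruct H as (d & H).
  apply (@succ_neq_zero _ ax d). apply (plus_cancel n).
  transitivity (n + d + 1); [ring | rewrite <- H; ring].
Qed.

Lemma less_trans (l m n : num M) : l < m -> m < n -> l < n.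
Proof.
  intros H H'. apply less_iff in H. apply less_iff in H'.
  destruct H as (d & ->), H' as (d' & ->).
  apply (@less_intro _ _ (d + d' + 1)). ring.
Qed.

Lemma less_trichotomy (m n : num M) : m < n \/ m = n \/ n < m.
Proof.
  num_induct n.
  - destruct (zero_or_succ m) as [-> | (d & ->)]; [now right; left|].
    right; right. apply (@less_intro _ _ d). ring.
  - destruct IH as [H | [-> | H]].
    + left. apply (less_succ ax). now left.
    + left. apply (less_succ ax). now right.
    + apply less_iff in H. destruct H as (d & ->).
      destruct (zero_or_succ d) as [-> | (d' & ->)].
      * right; left. ring.
      * right; right. apply (@less_intro _ _ d'). ring.
Qed.

Lemma less_succ_diag (n : num M) : n < n + 1.
Proof. apply (less_succ ax). now right. Qed.

Lemma less_succ_iff (m n : num M) : m < n + 1 <-> m < n \/ m = n.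
Proof. apply (less_succ ax). Qed.

Lemma not_less (m n : num M) : ~ m < n <-> n < m + 1.
Proof.
  rewrite less_succ_iff. split.
  - intros H. destruct (less_trichotomy m n) as [H' | [-> | H']]; auto. contradiction.
  - intros [H | ->] H'; [|now apply less_irrefl in H'].
    apply (@less_irrefl m). eapply less_trans; eassumption.
Qed.

Lemma leq_iff (m n : num M) : m < n + 1 <-> exists d, n = m + d.
Proof.
  rewrite less_iff. split; intros (d & H); exists d.
  - apply (plus_cancel 1). rewrite H. ring.
  - rewrite H. ring.
Qed.

Lemma less_leq_trans (l m n : num M) : l < m -> m < n + 1 -> l < n.
Proof.
  intros H H'. apply less_succ_iff in H'. destruct H' as [H' | <-]; [|easy].
  eapply less_trans; eassumption.
Qed.

Lemma leq_less_trans (l m n : num M) : l < m + 1 -> m < n -> l < n.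
Proof.
  intros H H'. apply less_succ_iff in H. destruct H as [H | ->]; [|easy].
  eapply less_trans; eassumption.
Qed.

Lemma leq_trans (l m n : num M) : l < m + 1 -> m < n + 1 -> l < n + 1.
Proof. intros H H'. eapply leq_less_trans; eassumption. Qed.

Lemma less_leq (m n : num M) : m < n -> m < n + 1.
Proof. intros H. apply less_succ_iff. now left. Qed.

Lemma leq_refl_plus (m d : num M) : m < m + d + 1.
Proof. apply less_iff. now exists d. Qed.

Lemma zero_less_succ (n : num M) : 0 < n + 1.
Proof. apply (@less_intro _ _ n). ring. Qed.

Lemma num_not_less_zero (n : num M) : ~ n < 0.
Proof. apply (not_less_zero ax). Qed.

(** With s = i + j the code lies between s^2 and s^2 + s, hence below (s + 1)^2. *)
Lemma pair_sum_less (i j i' j' : num M) : i + j < i' + j' -> pair M i j < pair M i' j'.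
Proof.
  intros H. apply less_iff in H. destruct H as (d & H). unfold pair. rewrite H.
  apply (@less_intro _ _ (i + (j + j) + (i + j + (i + j)) * d + d * d + d + d + i')).
  ring.
Qed.

Lemma pair_inj (i j i' j' : num M) : pair M i j = pair M i' j' -> i = i' /\ j = j'.
Proof.
  intros H.
  assert (Hs : i + j = i' + j').
  { destruct (less_trichotomy (i + j) (i' + j')) as [Hl | [He | Hl]]; [|easy|];
      apply pair_sum_less in Hl; rewrite H in Hl; now apply less_irrefl in Hl. }
  unfold pair in H. rewrite Hs, !(plus_comm (_ * _)) in H. apply plus_cancel in H.
  subst i'. split; [easy|].
  rewrite !(plus_comm i) in Hs. now apply plus_cancel in Hs.
Qed.

Lemma subset_prod_holds R P Q p q : subset_prod M R P Q -> holds M R p q ->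
  p \in P /\ q \in Q.
Proof.
  intros H Hpq. destruct (H _ Hpq) as (p' & q' & Hp & Hq & He).
  apply pair_inj in He. now destruct He as (-> & ->).
Qed.

Lemma leq_square (n : num M) : exists d, n * n = n + d.
Proof.
  destruct (zero_or_succ n) as [-> | (m & ->)].
  - exists 0. ring.
  - exists (m * m + m). ring.
Qed.

Lemma pair_left_leq (i j : num M) : i < pair M i j + 1.
Proof. apply leq_iff. unfold pair. exists ((i + j) * (i + j)). ring. Qed.

Lemma pair_right_leq (i j : num M) : j < pair M i j + 1.
Proof.
  apply leq_iff. unfold pair. destruct (leq_square (i + j)) as (d & ->).
  exists (i + i + d). ring.
Qed.

Lemma leq_plus (a b c d : num M) : a < b + 1 -> c < d + 1 -> a + c < b + d + 1.
Proof.
  rewrite !leq_iff. intros (x & ->) (y & ->). exists (x + y). ring.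
Qed.

Lemma leq_times (a b c d : num M) : a < b + 1 -> c < d + 1 -> a * c < b * d + 1.
Proof.
  rewrite !leq_iff. intros (x & ->) (y & ->). exists (a * y + c * x + x * y). ring.
Qed.

Lemma pair_leq (i j i' j' : num M) :
  i < i' + 1 -> j < j' + 1 -> pair M i j < pair M i' j' + 1.
Proof. intros Hi Hj. unfold pair. auto using leq_plus, leq_times. Qed.

Lemma upper_bound (m n : num M) : exists k, m < k /\ n < k.
Proof.
  exists (m + n + 1). split; [apply (@less_intro _ _ n) | apply (@less_intro _ _ m)]; ring.
Qed.

Lemma one_neq_zero : (1 : num M) <> 0.
Proof. rewrite <- (zero_plus 1). apply (succ_neq_zero ax). Qed.

Lemma less_one (n : num M) : n < 1 <-> n = 0.
Proof.
  rewrite <- (zero_plus 1), less_succ_iff. split; [|auto].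
  intros [H | H]; [now apply num_not_less_zero in H | easy].
Qed.

(** A single number y above both witnesses takes their place; the two quantifiers below y are
    bounded. *)
Lemma Sigma1_ex (P : num M -> (nat -> num M) -> Prop) :
  Sigma1 M (fun e => P (e O) (fun n => e (S n))) -> Sigma1 M (fun e => exists x, P x e).
Proof.
  intros (Q & HQ & HP).
  exists (fun y e => exists x, x < y /\ exists k, k < y /\
    Q k (fun n => match n with O => x | S n' => e n' end)).
  split.
  - cbv beta. apply Delta0_ex with (P := fun x e => exists k, k < e O /\
      Q k (fun n => match n with O => x | S n' => e (S n') end)); [polynomial|].
    apply Delta0_ex with (P := fun k e =>
      Q k (fun n => match n with O => e O | S n' => e (S (S n')) end)); [polynomial|].
    apply (Delta0_rename (fun n => match n with S (S n') => S (S (S n')) | _ => n end)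
      (fun e n => match n with O => e O | S n1 =>
         match n1 with O => e 1%nat | S n' => e (S (S (S n'))) end end) HQ).
    intros e n. now destruct n as [|[|n]].
  - intros e.
    assert (Hx : forall x, P x e <-> exists k,
      Q k (fun n => match n with O => x | S n' => e n' end))
      by (intros x; apply (HP (fun n => match n with O => x | S n' => e n' end))).
    split.
    + intros (x & H). apply Hx in H. destruct H as (k & H).
      destruct (upper_bound x k) as (y & Hxy & Hky). eauto 7.
    + intros (y & x & _ & k & _ & H). exists x. apply Hx. eauto.
Qed.

Lemma least (P : num M -> Prop) : Delta0 M (fun e => P (e O)) ->
  (exists n, P n) -> exists n, P n /\ forall m, m < n -> ~ P m.
Proof.
  intros HP (n & Hn). apply NNPP. intros HN.
  assert (H : forall n m, m < n -> ~ P m).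
  { clear n Hn. intros n. num_induct n.
    - intros m Hm. now apply num_not_less_zero in Hm.
    - intros m Hm Pm. apply HN. exists m. split; [easy|].
      intros l Hl. apply IH. eapply less_leq_trans; eassumption. }
  exact (H _ _ (less_succ_diag n) Hn).
Qed.

(** The term is brought in by a bounded quantifier over an x equal to it, which avoids substitution
    in formulas. *)
Lemma Delta0_subst (P : num M -> (nat -> num M) -> Prop) t : polynomial M t ->
  Delta0 M (fun e => P (e O) (fun n => e (S n))) -> Delta0 M (fun e => P (t e) e).
Proof.
  intros Ht HP.
  apply Delta0_ext with (P := fun e => exists x, x < t e + 1 /\ (x = t e /\ P x e)).
  - intros e; split.
    + intros (x & _ & -> & H); exact H.
    + intros H. exists (t e). repeat split; auto. apply less_succ_diag.
  - apply Delta0_ex with (P := fun x e => x = t e /\ P x e); [polynomial|].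
    apply Delta0_and; [|exact HP].
    apply Delta0_eq; [polynomial|].
    now apply polynomial_shift.
Qed.

Lemma Delta0_at (P : num M -> Prop) t :
  Delta0 M (fun e => P (e O)) -> polynomial M t -> Delta0 M (fun e => P (t e)).
Proof. intros HP Ht. now apply Delta0_subst with (P := fun x _ => P x). Qed.

Lemma Delta0_at2 (P : num M -> num M -> Prop) s t :
  Delta0 M (fun e => P (e O) (e 1%nat)) -> polynomial M s -> polynomial M t ->
  Delta0 M (fun e => P (s e) (t e)).
Proof.
  intros HP Hs Ht.
  apply Delta0_subst with (P := fun x e => P x (t e)); [easy|].
  apply polynomial_shift in Ht.
  apply Delta0_subst with (P := fun x e => P (e O) x); [easy|].
  apply (Delta0_rename (fun n => match n with O => 1%nat | S _ => O end)
    (fun e n => match n with O => e 1%nat | S _ => e O end) HP).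
  now intros e [|n].
Qed.

Definition divides (c n : num M) : Prop := exists q, n = c * q.

Lemma divides_times_r c m n : divides c m -> divides c (m * n).
Proof. intros (q & ->). exists (q * n). ring. Qed.

Lemma divides_minus c m n : divides c (m + n) -> divides c m -> divides c n.
Proof.
  intros (q & Hq) (r & ->).
  destruct (less_trichotomy r (q + 1)) as [H | H].
  - apply leq_iff in H. destruct H as (d & ->). exists d.
    apply (plus_cancel (c * r)). rewrite plus_comm, Hq. ring.
  - assert (Hn : exists d, r = q + d).
    { apply leq_iff. destruct H as [-> | H]; [|apply less_succ_iff; left];
      [apply less_succ_iff; left; apply less_succ_diag|].
      now apply less_trans with (q + 1); [apply less_succ_diag|]. }
    destruct Hn as (d & ->). exists 0.
    replace (c * 0) with (0 : num M) by ring.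
    destruct (zero_or_succ n) as [|(n' & ->)]; [easy|].
    exfalso. apply (@less_irrefl (c * q)). apply (@less_intro _ _ (c * d + n')).
    rewrite <- Hq at 1. ring.
Qed.

Lemma divides_pos c n : n <> 0 -> divides c n -> c < n + 1.
Proof.
  intros Hn (q & ->). destruct (zero_or_succ q) as [-> | (r & ->)].
  - exfalso. apply Hn. ring.
  - apply leq_iff. exists (c * r). ring.
Qed.

Lemma divides_bound c n : c <> 0 ->
  divides c n <-> exists q, q < n + 1 /\ n = c * q.
Proof.
  intros Hc. split; [|intros (q & _ & H); now exists q].
  intros (q & H). exists q. split; [|easy]. rewrite H.
  destruct (zero_or_succ c) as [|(d & ->)]; [easy|].
  apply leq_iff. exists (d * q). ring.
Qed.

(** These are the moduli of Gödel's beta function, as they occur in [triple_mem]. *)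
Definition modulus (m x : num M) : num M := m * (x + 1) + 1.

(** A divisor d of m divides [modulus m x] minus 1 and is therefore invertible modulo it. *)
Lemma modulus_divides_times m x d n : divides d m ->
  divides (modulus m x) (n * d) -> divides (modulus m x) n.
Proof.
  intros (e & ->) H. apply divides_minus with (n * d * (e * (x + 1))).
  - exists n. unfold modulus. ring.
  - now apply divides_times_r.
Qed.

(** The multiples [(x + 1) * modulus m y] and [(y + 1) * modulus m x] differ by x - y, whose
    absolute value divides m and is cancelled by [modulus_divides_times]. *)
Lemma moduli_coprime m k x y n : (forall d, d < k -> divides (d + 1) m) ->
  x < k -> y < k -> x <> y ->
  divides (modulus m x) (n * modulus m y) -> divides (modulus m x) n.
Proof.
  intros Hm Hx Hy Hxy H.
  destruct (less_trichotomy x y) as [Hl | [He | Hl]]; [|contradiction|];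
    apply less_iff in Hl; destruct Hl as (d & Hd).
  - apply modulus_divides_times with (d + 1).
    { apply Hm. apply leq_less_trans with y; [|easy]. rewrite Hd.
      apply leq_iff. exists (x + 1). ring. }
    apply divides_minus with (n * modulus m y * (x + 1)); [|now apply divides_times_r].
    exists (n * (y + 1)). rewrite Hd. unfold modulus. ring.
  - apply modulus_divides_times with (d + 1).
    { apply Hm. apply leq_less_trans with x; [|easy]. rewrite Hd.
      apply leq_iff. exists (y + 1). ring. }
    apply divides_minus with (n * (y + 1) * modulus m x).
    + replace (_ + _) with (n * modulus m y * (x + 1)); [now apply divides_times_r|].
      rewrite Hd. unfold modulus. ring.
    + exists (n * (y + 1)). ring.
Qed.

Lemma Delta0_divides s t : polynomial M s -> polynomial M t ->
  Delta0 M (fun e => divides (s e) (t e)).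
Proof.
  intros Hs Ht.
  apply Delta0_ext with (P := fun e => exists q, q < t e + 1 /\ t e = s e * q).
  - intros e. destruct (zero_or_succ (s e)) as [H | (d & H)].
    + rewrite H. split.
      * intros (q & _ & Hq). now exists q.
      * intros (q & Hq). exists 0. rewrite Hq. split; [|ring]. rewrite zero_times, zero_plus.
        apply less_one. easy.
    + symmetry. apply divides_bound. rewrite H. apply (succ_neq_zero ax).
  - apply Delta0_ex with (P := fun q e => t e = s e * q); [polynomial|].
    apply Delta0_eq; [|apply polynomial_times; [|polynomial]]; now apply polynomial_shift.
Qed.
End Arithmetic.

Arguments less_trans [M] HM [l m n].
Arguments leq_trans [M] HM [l m n].
Arguments less_leq_trans [M] HM [l m n].
Arguments leq_less_trans [M] HM [l m n].
Arguments less_leq [M] HM [m n].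
Arguments less_irrefl [M] HM [n].
Arguments pair_inj [M] HM [i j i' j'].
Arguments subset_prod_holds [M] HM [R P Q p q].
Arguments num_not_less_zero [M] HM [n].
Arguments moduli_coprime [M] HM [m k x y n].

#[local] Hint Extern 1 (Delta0 _ (fun e => divides _ _ _)) =>
  apply Delta0_divides; [assumption | polynomial | polynomial] : delta0.

(** * Codes of finite sets *)

Section Codes.
Variable M : L2_structure.
Hypothesis HM : RCA0 M.

Let ax : basic_axioms M := RCA0_basic HM.
Add Ring num_ring : (num_semi_ring HM).

(** The number built is the factorial of k; Sigma1 induction is used because no bound on it is at
    hand. *)
Lemma common_multiple k : exists m : num M, m <> 0 /\
  forall d, d < k -> divides M (d + 1) m.
Proof.
  sigma_induct k.
  - apply Sigma1_ex_Delta0. delta0.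
  - exists 1. split; [apply (one_neq_zero HM)|].
    intros d Hd. now apply (num_not_less_zero HM) in Hd.
  - intros k (m & Hm & Hd). exists (m * (k + 1)). split.
    + intros H. destruct (zero_or_succ HM m) as [-> | (m' & ->)]; [now apply Hm|].
      apply (@succ_neq_zero _ ax (m' * k + m' + k)). rewrite <- H. ring.
    + intros d Hk. apply (less_succ_iff HM) in Hk. destruct Hk as [Hk | ->].
      * apply (divides_times_r HM). auto.
      * exists m. ring.
Qed.

Lemma moduli_common_multiple m k : exists n : num M, n <> 0 /\
  forall x, x < k -> divides M (modulus M m x) n.
Proof.
  sigma_induct k.
  - apply Sigma1_ex_Delta0. delta0.
  - exists 1. split; [apply (one_neq_zero HM)|].
    intros d Hd. now apply (num_not_less_zero HM) in Hd.
  - intros k (n & Hn & Hd). exists (n * modulus M m k). split.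
    + intros H. destruct (zero_or_succ HM n) as [-> | (n' & ->)]; [now apply Hn|].
      apply (@succ_neq_zero _ ax (n' * (m * (k + 1)) + n' + m * (k + 1))).
      rewrite <- H. unfold modulus. ring.
    + intros x Hk. apply (less_succ_iff HM) in Hk. destruct Hk as [Hk | ->].
      * apply (divides_times_r HM). auto.
      * exists n. ring.
Qed.

(** [b] exceeds a triple for each set of numbers below [k]: all of them can use
    the same [m], and a divisor of the same [N] as the third component. *)
Definition code_bound (k b : num M) : Prop :=
  exists m, m < b /\ exists N, N < b /\ (b = pair M k (pair M m N) + 1 /\
  m <> 0 /\ (forall d, d < k -> divides M (d + 1) m) /\
  N <> 0 /\ forall x, x < k -> divides M (modulus M m x) N).

Lemma code_bound_exists k : exists b, code_bound k b.
Proof.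
  destruct (common_multiple k) as (m & Hm & Hd).
  destruct (moduli_common_multiple m k) as (N & HN & Hx).
  exists (pair M k (pair M m N) + 1).
  assert (Hp := pair_right_leq HM k (pair M m N)).
  exists m. split.
  { exact (leq_trans HM (pair_left_leq HM m N) Hp). }
  exists N. split; [exact (leq_trans HM (pair_right_leq HM m N) Hp)|].
  auto.
Qed.

Lemma divisor_of_moduli k m N (Q : num M -> Prop) :
  Delta0 M (fun e => Q (e O)) ->
  m <> 0 -> (forall d, d < k -> divides M (d + 1) m) ->
  N <> 0 -> (forall x, x < k -> divides M (modulus M m x) N) ->
  exists n, n < N + 1 /\ forall x, x < k -> (divides M (modulus M m x) n <-> Q x).
Proof.
  intros HQ Hm Hd HN Hx.
  (* Here n is the product of the moduli of those x < j that satisfy [Q]. The last clause says that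
     n is coprime to the moduli still to come, which keeps the next product a divisor of N; the
     bounds by N make the invariant Delta0. *)
  assert (H : forall j, j < k + 1 -> exists n, n < N + 1 /\ (divides M n N /\
    (forall x, x < k -> (divides M (modulus M m x) n <-> x < j /\ Q x)) /\
    forall y, y < k -> ~ y < j -> forall w, w < N + 1 ->
      divides M (modulus M m y) (n * w) -> divides M (modulus M m y) w)).
  { intros j. num_induct j.
    - intros _. exists 1. split; [|split; [|split]].
      + apply (divides_pos HM); [easy|]. exists N. ring.
      + exists N. ring.
      + intros x _. split; [|intros [H _]; now apply (num_not_less_zero HM) in H].
        intros H. exfalso. apply (divides_pos HM) in H; [|apply (one_neq_zero HM)].
        apply (leq_iff HM) in H. destruct H as (d & H).
        destruct (zero_or_succ HM m) as [-> | (m' & ->)]; [now apply Hm|].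
        apply (@succ_neq_zero _ ax (m' * (x + 1) + x + d)). symmetry.
        apply (plus_cancel HM 1). unfold modulus in H.
        transitivity (1 : num M); [ring|]. rewrite H at 1. ring.
      + intros y _ _ w _. now replace (1 * w) with w by ring.
    - intros Hj.
      apply (less_succ_iff HM) in Hj.
      assert (Hjk : j < k).
      { destruct Hj as [Hj | <-]; [|apply (less_succ_diag HM)].
        now apply (less_trans HM) with (j + 1); [apply (less_succ_diag HM)|]. }
      destruct IH as (n & HnN & Hdiv & Hmem & Hcop); [now apply (less_leq HM)|].
      destruct (classic (Q j)) as [Qj | Qj].
      + assert (Hdiv' : divides M (n * modulus M m j) N).
        { destruct Hdiv as (w & Hw).
          destruct (Hcop j Hjk (less_irrefl HM (n := j)) w) as (q & Hq).
          - destruct (zero_or_succ HM n) as [-> | (n' & ->)].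
            + exfalso. apply HN. rewrite Hw. ring.
            + rewrite Hw. apply (leq_iff HM). exists (n' * w). ring.
          - rewrite <- Hw. auto.
          - exists q. rewrite Hw, Hq. ring. }
        exists (n * modulus M m j). split; [now apply (divides_pos HM)|].
        split; [easy | split].
        * intros x Hxk. rewrite (less_succ_iff HM). split.
          -- intros H. destruct (classic (x = j)) as [-> | Hne]; [auto|].
             apply (moduli_coprime HM Hd Hxk Hjk Hne) in H.
             apply Hmem in H; tauto.
          -- intros [[Hxj | ->] Qx].
             ++ apply (divides_times_r HM). now apply Hmem.
             ++ exists n. ring.
        * intros y Hy Hyj w Hw H.
          assert (Hyj' : ~ y < j) by (intros H'; apply Hyj; now apply (less_leq HM)).
          apply (Hcop y Hy Hyj' w Hw).
          apply (moduli_coprime HM Hd Hy Hjk).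
          -- intros ->. apply Hyj, (less_succ_diag HM).
          -- now replace (n * w * modulus M m j) with (n * modulus M m j * w) by ring.
      + exists n. split; [easy | split; [easy | split]].
        * intros x Hxk. rewrite (Hmem x Hxk), (less_succ_iff HM).
          split; [tauto|]. intros [[H | ->] Qx]; tauto.
        * intros y Hy Hyj. apply (Hcop y Hy). intros H. apply Hyj. now apply (less_leq HM). }
  destruct (H k (less_succ_diag HM k)) as (n & Hn & _ & Hmem & _).
  exists n. split; [easy|]. intros x Hxk. rewrite (Hmem x Hxk). tauto.
Qed.

Lemma code_mem_triple k m n x :
  code_mem M (pair M k (pair M m n)) x <-> x < k /\ divides M (modulus M m x) n.
Proof.
  split.
  - intros (k' & m' & n' & He & H). apply (pair_inj HM) in He. destruct He as (-> & He).
    apply (pair_inj HM) in He. destruct He as (-> & ->). exact H.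
  - intros H. exists k, m, n. split; [easy | exact H].
Qed.

Lemma code_mem_pair k m n x :
  code_mem M (pair M k (pair M m n)) x <-> triple_mem M k m n x.
Proof. exact (code_mem_triple k m n x). Qed.

Lemma triple_bounds k m n : k < pair M k (pair M m n) + 1 /\
  m < pair M k (pair M m n) + 1 /\ n < pair M k (pair M m n) + 1.
Proof.
  assert (Hp := pair_right_leq HM k (pair M m n)). repeat split.
  - apply (pair_left_leq HM).
  - exact (leq_trans HM (pair_left_leq HM m n) Hp).
  - exact (leq_trans HM (pair_right_leq HM m n) Hp).
Qed.

Lemma code_mem_less s x : code_mem M s x -> x < s.
Proof.
  intros (k & m & n & -> & H & _). apply (less_leq_trans HM) with k; [easy|].
  apply triple_bounds.
Qed.

Definition is_triple (s : num M) : Prop :=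
  exists k, k < s + 1 /\ exists m, m < s + 1 /\ exists n, n < s + 1 /\
  s = pair M k (pair M m n).

Lemma is_triple_iff s : is_triple s <-> exists k m n, s = pair M k (pair M m n).
Proof.
  split.
  - intros (k & _ & m & _ & n & _ & ->). eauto.
  - intros (k & m & n & ->). destruct (triple_bounds k m n) as (Hk & Hm & Hn).
    exists k. split; [easy|]. exists m. split; [easy|]. exists n. auto.
Qed.

Lemma Delta0_code_mem_var : Delta0 M (fun e => code_mem M (e O) (e 1%nat)).
Proof.
  apply Delta0_ext with (P := fun e => exists k, k < e O + 1 /\
    exists m, m < e O + 1 /\ exists n, n < e O + 1 /\ (e O = pair M k (pair M m n) /\
    e 1%nat < k /\ divides M (modulus M m (e 1%nat)) n)).
  - intros e. split.
    + intros (k & _ & m & _ & n & _ & -> & H). now apply code_mem_triple.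
    + intros (k & m & n & -> & H). destruct (triple_bounds k m n) as (Hk & Hm & Hn).
      exists k. split; [easy|]. exists m. split; [easy|]. exists n. auto.
  - delta0.
Qed.

Lemma Delta0_code_mem s t : polynomial M s -> polynomial M t ->
  Delta0 M (fun e => code_mem M (s e) (t e)).
Proof. apply (Delta0_at2 HM (code_mem M) Delta0_code_mem_var). Qed.

End Codes.

#[local] Hint Extern 1 (Delta0 _ (fun e => code_mem _ _ _)) =>
  apply Delta0_code_mem; [assumption | polynomial | polynomial] : delta0.

(** * Canonical codes of finite sets and bounds for them *)

Section Canonical_codes.
Variable M : L2_structure.
Hypothesis HM : RCA0 M.

(** Members lie below their code, so whether two codes define the same set can be tested below the
    larger code. *)
Lemma Delta0_set_code s : polynomial M s -> Delta0 M (fun e => set_code M (s e)).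
Proof.
  apply (Delta0_at HM).
  apply Delta0_ext with (P := fun e => is_triple M (e O) /\
    forall t, t < e O -> is_triple M t ->
    ~ forall x, x < e O -> (code_mem M t x <-> code_mem M (e O) x)).
  - intros e. unfold set_code. rewrite (is_triple_iff HM).
    apply and_iff_compat_l. split.
    + intros H k m n Hl HN. apply (H _ Hl); [now apply (is_triple_iff HM); eauto|].
      intros x _. rewrite <- HN. apply (code_mem_pair HM).
    + intros H t Ht Htr HN. apply (is_triple_iff HM) in Htr.
      destruct Htr as (k & m & n & ->). apply (H k m n Ht). intros x.
      rewrite <- (code_mem_pair HM). split; intros Hx; apply HN; auto.
      * apply (code_mem_less HM) in Hx. exact (less_trans HM Hx Ht).
      * now apply (code_mem_less HM).
  - unfold is_triple. delta0.
Qed.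

Lemma code_ext s t : set_code M s -> set_code M t ->
  (forall x, code_mem M s x <-> code_mem M t x) -> s = t.
Proof.
  intros [Hs Ms] [Ht Mt] H.
  destruct Hs as (k & m & n & ->), Ht as (k' & m' & n' & ->).
  destruct (less_trichotomy HM (pair M k (pair M m n)) (pair M k' (pair M m' n')))
    as [Hl | [He | Hl]]; [exfalso | easy | exfalso].
  - apply (Mt _ _ _ Hl). intros x. rewrite <- H. symmetry. apply (code_mem_pair HM).
  - apply (Ms _ _ _ Hl). intros x. rewrite H. symmetry. apply (code_mem_pair HM).
Qed.

Lemma canonical_code s : is_triple M s ->
  exists t, t < s + 1 /\ set_code M t /\ forall x, code_mem M t x <-> code_mem M s x.
Proof.
  intros Hs.
  destruct (least HM (fun t => is_triple M t /\
    forall x, x < t + s + 1 -> (code_mem M t x <-> code_mem M s x))) as (t & (Ht & Hm) & Hl).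
  - unfold is_triple. delta0.
  - exists s. split; [easy|]. tauto.
  - assert (Hx : forall x, code_mem M t x <-> code_mem M s x).
    { intros x. split; intros H; apply Hm; auto; apply (code_mem_less HM) in H.
      - apply (less_trans HM H). apply (leq_refl_plus HM).
      - apply (less_leq_trans HM H). apply (leq_iff HM). exists (t + 1).
        now rewrite !(plus_comm HM _ s), <- (plus_assoc HM), (plus_comm HM s). }
    exists t. split; [|split; [split|easy]].
    + apply (not_less HM). intros H. apply (Hl s H). split; [easy|]. tauto.
    + now apply (is_triple_iff HM).
    + intros k m n Hkmn HN. apply (Hl _ Hkmn). split; [apply (is_triple_iff HM); eauto|].
      intros x _. now rewrite (code_mem_pair HM), <- Hx, <- HN.
Qed.

Lemma code_exists k b Q : code_bound M k b -> Delta0 M (fun e => Q (e O)) ->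
  exists s, s < b /\ set_code M s /\ forall x, code_mem M s x <-> x < k /\ Q x.
Proof.
  intros (m & _ & N & _ & -> & Hm & Hd & HN & Hx) HQ.
  destruct (divisor_of_moduli HM k Q HQ Hm Hd HN Hx) as (n & Hn & Hmem).
  destruct (@canonical_code (pair M k (pair M m n))) as (s & Hs & Hc & Hs').
  { apply (is_triple_iff HM). eauto. }
  exists s. split; [|split; [easy|]].
  - apply (leq_trans HM Hs). apply (pair_leq HM); [apply (less_succ_diag HM)|].
    apply (pair_leq HM); [apply (less_succ_diag HM) | easy].
  - intros x. rewrite Hs', (code_mem_triple HM). split; intros [H H']; (split; [easy|]);
      now apply Hmem.
Qed.

(** Some canonical code of the same set lies below b, and canonical codes are unique. Quantifiers
    over all sets of numbers below k thus become bounded. *)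
Lemma code_less_bound k b s : code_bound M k b -> set_code M s ->
  (forall x, code_mem M s x -> x < k) -> s < b.
Proof.
  intros Hb Hs Hk.
  destruct (code_exists (fun x => code_mem M s x) Hb) as (t & Ht & Htc & H); [delta0|].
  replace s with t; [easy|]. apply code_ext; auto. intros x. rewrite H. split; [tauto | auto].
Qed.

Lemma Delta0_code_bound s t : polynomial M s -> polynomial M t ->
  Delta0 M (fun e => code_bound M (s e) (t e)).
Proof.
  apply (Delta0_at2 HM (code_bound M)). unfold code_bound. delta0.
Qed.

End Canonical_codes.

#[local] Hint Extern 1 (Delta0 _ (fun e => set_code _ _)) =>
  apply Delta0_set_code; [assumption | polynomial] : delta0.
#[local] Hint Extern 1 (Delta0 _ (fun e => code_bound _ _ _)) =>
  apply Delta0_code_bound; [assumption | polynomial | polynomial] : delta0.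

(** * Binary sequences *)

Section Sequence_predicate.
Variable M : L2_structure.
Hypothesis HM : RCA0 M.

Lemma pair_bit_less i b l : i < l -> b = 0 \/ b = 1 -> pair M i b < pair M l 1.
Proof.
  intros Hi Hb. apply (pair_sum_less HM).
  apply (less_iff HM) in Hi. destruct Hi as (d & ->).
  destruct Hb as [-> | ->].
  - apply (less_intro HM _ (d + 1)).
    now rewrite !(plus_assoc HM), (plus_comm HM i 0), (zero_plus HM).
  - apply (less_intro HM _ d). rewrite <- !(plus_assoc HM). f_equal.
    now rewrite !(plus_assoc HM), (plus_comm HM d 1).
Qed.

Lemma Delta0_binary_seq s l : polynomial M s -> polynomial M l ->
  Delta0 M (fun e => binary_seq M (s e) (l e)).
Proof.
  apply (Delta0_at2 HM (binary_seq M)).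
  apply Delta0_ext with (P := fun e => set_code M (e O) /\
    (forall z, z < e O -> code_mem M (e O) z -> exists i, i < z + 1 /\
       exists b, b < z + 1 /\ (i < e 1%nat /\ (b = 0 \/ b = 1) /\ z = pair M i b)) /\
    (forall i, i < e 1%nat -> exists b, b < 1 + 1 /\ code_mem M (e O) (pair M i b)) /\
    (forall i, i < e O -> forall b, b < e O -> forall c, c < e O ->
       code_mem M (e O) (pair M i b) -> code_mem M (e O) (pair M i c) -> b = c)).
  - intros e. unfold binary_seq. apply and_iff_compat_l.
    assert (Hb : forall i b, code_mem M (e O) (pair M i b) -> i < e O /\ b < e O).
    { intros i b H. apply (code_mem_less HM) in H. split.
      - exact (leq_less_trans HM (pair_left_leq HM i b) H).
      - exact (leq_less_trans HM (pair_right_leq HM i b) H). }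
    split; intros (H1 & H2 & H3); (split; [|split]).
    + intros z Hz. destruct (H1 z (code_mem_less HM Hz) Hz) as (i & _ & b & _ & H). eauto.
    + intros i Hi. destruct (H2 i Hi) as (b & _ & H). eauto.
    + intros i b c Hib Hic. destruct (Hb _ _ Hib), (Hb _ _ Hic). now apply (H3 i) with (b := b).
    + intros z _ Hz. destruct (H1 z Hz) as (i & b & Hi & Hbit & ->).
      exists i. split; [apply (pair_left_leq HM)|].
      exists b. split; [apply (pair_right_leq HM)|]. auto.
    + intros i Hi. destruct (H2 i Hi) as (b & H). exists b. split; [|easy].
      destruct (H1 _ H) as (i' & b' & _ & Hbit & He). apply (pair_inj HM) in He.
      destruct He as (_ & ->). apply (less_succ_iff HM). rewrite (less_one HM). exact Hbit.
    + eauto.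
  - delta0.
Qed.

End Sequence_predicate.

#[local] Hint Extern 1 (Delta0 _ (fun e => binary_seq _ _ _)) =>
  apply Delta0_binary_seq; [assumption | polynomial | polynomial] : delta0.

Section Sequences.
Variable M : L2_structure.
Hypothesis HM : RCA0 M.

Definition bit (Q : num M -> Prop) (i b : num M) : Prop :=
  (b = 1 /\ Q i) \/ (b = 0 /\ ~ Q i).

Lemma bit_exists Q i : exists b, bit Q i b.
Proof. destruct (classic (Q i)); [exists 1 | exists 0]; unfold bit; auto. Qed.

Lemma bit_range Q i b : bit Q i b -> b = 0 \/ b = 1.
Proof. unfold bit; tauto. Qed.

Lemma bit_unique Q i b c : bit Q i b -> bit Q i c -> b = c.
Proof. unfold bit. intros [[-> H] | [-> H]] [[-> H'] | [-> H']]; tauto. Qed.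

Lemma binary_seq_exists (Q : num M -> Prop) l : Delta0 M (fun e => Q (e O)) ->
  exists s, binary_seq M s l /\
    forall i b, code_mem M s (pair M i b) <-> i < l /\ bit Q i b.
Proof.
  intros HQ. destruct (code_bound_exists HM (pair M l 1)) as (k & Hk).
  destruct (code_exists HM (fun x => exists i, i < x + 1 /\ exists b, b < x + 1 /\
    (x = pair M i b /\ i < l /\ bit Q i b)) Hk) as (s & _ & Hs & Hmem).
  { pose proof (fun t => Delta0_at HM Q (t := t) HQ) as HQ'. unfold bit. delta0.
    - apply HQ'. polynomial.
    - apply HQ'. polynomial. }
  assert (H : forall i b, code_mem M s (pair M i b) <-> i < l /\ bit Q i b).
  { intros i b. rewrite Hmem. split.
    - intros (_ & i' & _ & b' & _ & He & H). apply (pair_inj HM) in He.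
      now destruct He as (-> & ->).
    - intros (Hi & Hb). split; [eapply pair_bit_less; eauto using bit_range|].
      exists i. split; [apply (pair_left_leq HM)|].
      exists b. split; [apply (pair_right_leq HM)|]. auto. }
  exists s. split; [|easy]. split; [easy|]. split; [|split].
  - intros z Hz. apply Hmem in Hz.
    destruct Hz as (_ & i & _ & b & _ & -> & Hi & Hb).
    exists i, b. eauto using bit_range.
  - intros i Hi. destruct (bit_exists Q i) as (b & Hb). exists b. now apply H.
  - intros i b c Hb Hc. apply H in Hb, Hc. destruct Hb, Hc. eauto using bit_unique.
Qed.

Lemma binary_seq_ext s t l : binary_seq M s l -> binary_seq M t l ->
  (forall i b, code_mem M s (pair M i b) -> code_mem M t (pair M i b)) -> s = t.
Proof.
  intros (Hs & Hs1 & Hs2 & Hs3) (Ht & Ht1 & Ht2 & Ht3) H.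
  apply (code_ext HM); auto. intros x. split; intros Hx.
  - destruct (Hs1 x Hx) as (i & b & _ & _ & ->). auto.
  - destruct (Ht1 x Hx) as (i & b & Hi & _ & ->).
    destruct (Hs2 i Hi) as (c & Hc). replace b with c; [easy|].
    apply (Ht3 i); auto.
Qed.

Lemma binary_seq_index s l i b : binary_seq M s l ->
  code_mem M s (pair M i b) -> i < l /\ (b = 0 \/ b = 1).
Proof.
  intros (_ & H & _) Hi. destruct (H _ Hi) as (i' & b' & Hl & Hb & He).
  apply (pair_inj HM) in He. now destruct He as (-> & ->).
Qed.

Arguments binary_seq_index [s l i b].

Lemma binary_seq_less_bound s l k : binary_seq M s l ->
  code_bound M (pair M l 1) k -> s < k.
Proof.
  intros (Hs & H & _) Hk. apply (code_less_bound HM Hk Hs).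
  intros x Hx. destruct (H x Hx) as (i & b & Hi & Hb & ->). now apply pair_bit_less.
Qed.

(** If l = m + 1, a pair with first component m is a member and so lies below s. This makes
    quantifiers over the length of s bounded. *)
Lemma binary_seq_length_leq s l : binary_seq M s l -> l < s + 1.
Proof.
  intros (_ & _ & H & _). destruct (zero_or_succ HM l) as [-> | (m & ->)].
  - apply (zero_less_succ HM).
  - destruct (H m (less_succ_diag HM m)) as (b & Hb). apply (code_mem_less HM) in Hb.
    apply (not_less HM). intros Hs. apply (less_irrefl HM (n := m)).
    apply (leq_less_trans HM (pair_left_leq HM m b)).
    exact (less_leq_trans HM Hb Hs).
Qed.

Lemma binary_seq_length_unique s l l' : binary_seq M s l -> binary_seq M s l' -> l = l'.
Proof.
  intros Hs Hs'.
  enough (H : forall l l', binary_seq M s l -> binary_seq M s l' -> ~ l < l').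
  { destruct (less_trichotomy HM l l') as [Hl | [He | Hl]]; [exfalso | easy | exfalso].
    - exact (H _ _ Hs Hs' Hl).
    - exact (H _ _ Hs' Hs Hl). }
  clear - HM. intros l l' Hs (_ & _ & H & _) Hl. destruct (H l Hl) as (b & Hb).
  apply (binary_seq_index Hs) in Hb. now apply (less_irrefl HM (n := l)).
Qed.

Lemma binary_seq_restrict s l j : binary_seq M s l -> j < l + 1 ->
  exists t, binary_seq M t j /\
    forall i b, code_mem M t (pair M i b) <-> i < j /\ code_mem M s (pair M i b).
Proof.
  intros Hs Hj. destruct (@binary_seq_exists (fun i => code_mem M s (pair M i 1)) j)
    as (t & Ht & H); [delta0|].
  exists t. split; [easy|]. intros i b. rewrite H. unfold bit.
  split; intros (Hi & Hb); (split; [easy|]).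
  - destruct Hb as [(-> & Hb) | (-> & Hb)]; [easy|].
    destruct Hs as (Hc & H1 & H2 & H3). destruct (H2 i) as (c & Hc').
    { exact (less_leq_trans HM Hi Hj). }
    destruct (binary_seq_index (conj Hc (conj H1 (conj H2 H3))) Hc') as (_ & [-> | ->]);
      [easy | contradiction].
  - destruct (binary_seq_index Hs Hb) as (_ & [-> | ->]); [|auto].
    right. split; [easy|]. intros H1. apply (one_neq_zero HM).
    destruct Hs as (_ & _ & _ & H3). now apply (H3 i).
Qed.

End Sequences.

Arguments binary_seq_index [M] HM [s l i b].
Arguments binary_seq_restrict [M] HM [s l j].
Arguments binary_seq_length_unique [M] HM [s l l'].
Arguments binary_seq_ext [M] HM [s t l].
Arguments binary_seq_less_bound [M] HM [s l k].

#[local] Hint Extern 2 (Delta0 ?M (fun e => ?Q (@?t e))) =>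
  match goal with H : Delta0 M (fun e => Q (e O)) |- _ =>
    apply (Delta0_at ltac:(eassumption) Q H); polynomial end : delta0.
#[local] Hint Extern 2 (Delta0 ?M (fun e => ?Q (@?s e) (@?t e))) =>
  match goal with H : Delta0 M (fun e => Q (e O) (e 1%nat)) |- _ =>
    apply (Delta0_at2 ltac:(eassumption) Q H); polynomial end : delta0.

(** * Linear extensions from weak König's lemma *)

Section Compactness.
Variable M : L2_structure.
Hypothesis HM : RCA0 M.
Hypothesis HW : weak_Konig_lemma M.

(** A literal [pair i 1] or [pair i 0] asserts that [i] is, or is not, in the
    wanted set. *)
Lemma compactness (Bad : num M -> num M -> num M -> Prop) :
  Delta0 M (fun e => Bad (e O) (e 1%nat) (e 2%nat)) ->
  (forall n, exists Q, Delta0 M (fun e => Q (e O)) /\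
     forall i j k a b c, i < n -> j < n -> k < n -> bit M Q i a -> bit M Q j b ->
       bit M Q k c -> ~ Bad (pair M i a) (pair M j b) (pair M k c)) ->
  exists X, forall i j k a b c, bit M (fun i => i \in X) i a ->
    bit M (fun i => i \in X) j b -> bit M (fun i => i \in X) k c ->
    ~ Bad (pair M i a) (pair M j b) (pair M k c).
Proof.
  intros HBad Hfin.
  (* A node of the tree is a finite assignment without a bad triple of literals. *)
  destruct (@Delta0_comprehension _ HM (fun s => exists l, l < s + 1 /\ (binary_seq M s l /\
    forall x, x < s -> forall y, y < s -> forall z, z < s -> code_mem M s x ->
      code_mem M s y -> code_mem M s z -> ~ Bad x y z))) as (T & HT).
  { delta0.
    apply (Delta0_rename (fun n => match n with O => 2%nat | 1%nat => 1%nat | _ => O end)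
      (fun e n => match n with O => e 2%nat | 1%nat => e 1%nat | _ => e O end) HBad).
    now intros e [|[|n]]. }
  assert (HT' : forall s, s \in T <-> exists l, binary_seq M s l /\
    forall x y z, code_mem M s x -> code_mem M s y -> code_mem M s z -> ~ Bad x y z).
  { intros s. rewrite HT. split.
    - intros (l & _ & Hs & H). exists l. split; [easy|].
      intros x y z Hx Hy Hz. apply H; auto; now apply (code_mem_less HM).
    - intros (l & Hs & H). exists l. split; [eapply binary_seq_length_leq; eassumption|].
      split; auto. }
  destruct (HW (T := T)) as (g & Hg1 & Hg2 & Hg3 & Hg4).
  - split.
    + intros s Hs. apply HT' in Hs. destruct Hs as (l & H & _). now exists l.
    + intros s t l Hs Ht Hsub. apply HT' in Hs. destruct Hs as (_ & _ & H).
      apply HT'. exists l. auto.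
  - intros n. destruct (Hfin n) as (Q & HQ & H).
    destruct (binary_seq_exists HM Q n HQ) as (s & Hs & Hmem).
    exists s. split; [|].
    + apply HT'. exists n. split; [easy|]. intros x y z Hx Hy Hz.
      destruct Hs as (_ & Hs & _).
      destruct (Hs x Hx) as (i & a & _ & _ & ->), (Hs y Hy) as (j & b & _ & _ & ->),
        (Hs z Hz) as (k & c & _ & _ & ->).
      apply Hmem in Hx, Hy, Hz. now apply H.
    + apply (not_less HM). eapply binary_seq_length_leq; eassumption.
  - destruct (@Delta0_comprehension _ HM (fun i => pair M i 1 \in g)) as (X & HX); [delta0|].
    exists X.
    assert (Hbit : forall i a, bit M (fun i => i \in X) i a -> holds M g i a).
    { intros i a [[-> H] | [-> H]]; rewrite HX in H; [easy|].
      destruct (Hg2 i) as (b & Hb). destruct (Hg1 _ Hb) as (i' & b' & Hr & He).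
      apply (pair_inj HM) in He. destruct He as (-> & ->).
      destruct Hr as [-> | ->]; [easy | contradiction]. }
    intros i j k a b c Hi Hj Hk HB.
    apply Hbit in Hi, Hj, Hk.
    destruct (upper_bound HM i j) as (n1 & Hi1 & Hj1).
    destruct (upper_bound HM n1 k) as (n & Hn1 & Hkn).
    destruct (Hg4 n) as (s & Hs & _ & H). apply HT' in Hs.
    destruct Hs as (_ & _ & Hs).
    apply (Hs (pair M i a) (pair M j b) (pair M k c)); [apply H..|]; auto;
      eapply (less_trans HM); eassumption.
Qed.

(** The literals decide which pairs belong to the order. Every axiom of a linear order extending
    [Rel] forbids combinations of at most three literals, so compactness applies; an order on the
    elements below n satisfies all constraints on pairs with codes below n. *)
Lemma linear_extension (L : set M) (Rel : num M -> num M -> Prop) :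
  Delta0 M (fun e => Rel (e O) (e 1%nat)) ->
  (forall n, exists A : num M -> num M -> Prop, Delta0 M (fun e => A (e O) (e 1%nat)) /\
    (forall x y, x < n -> y < n -> x \in L -> y \in L -> A x y \/ A y x) /\
    (forall x y, x < n -> y < n -> x \in L -> y \in L -> A x y -> A y x -> x = y) /\
    (forall x y z, x < n -> y < n -> z < n -> x \in L -> y \in L -> z \in L ->
      A x y -> A y z -> A x z) /\
    (forall x y, x < n -> y < n -> x \in L -> y \in L -> Rel x y -> A x y)) ->
  exists RL, linear_order M L RL /\
    forall x y, x \in L -> y \in L -> Rel x y -> holds M RL x y.
Proof.
  intros HRel Hfin.
  (* The four alternatives are the violations of totality, of antisymmetry, of the inclusion of
     [Rel] and of transitivity. *)
  set (Bad := fun X Y Z => exists x, x < X + 1 /\ exists y, y < X + 1 /\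
    (x \in L /\ y \in L /\
      ((X = pair M (pair M x y) 0 /\ Y = pair M (pair M y x) 0) \/
       (X = pair M (pair M x y) 1 /\ Y = pair M (pair M y x) 1 /\ x <> y) \/
       (X = pair M (pair M x y) 0 /\ Rel x y) \/
       (X = pair M (pair M x y) 1 /\ exists z, z < Y + 1 /\
         (z \in L /\ Y = pair M (pair M y z) 1 /\ Z = pair M (pair M x z) 0))))).
  assert (Hpp : forall x y c, x < pair M (pair M x y) c + 1 /\ y < pair M (pair M x y) c + 1).
  { intros x y c. pose proof (pair_left_leq HM (pair M x y) c). split.
    - exact (leq_trans HM (pair_left_leq HM x y) H).
    - exact (leq_trans HM (pair_right_leq HM x y) H). }
  destruct (@compactness Bad) as (X & HX).
  - unfold Bad. delta0.
  - intros n. destruct (Hfin n) as (A & HA & Htot & Hanti & Htrans & Hext).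
    exists (fun i => exists x, x < i + 1 /\ exists y, y < i + 1 /\ (i = pair M x y /\ A x y)).
    split; [delta0|].
    intros i j k a b c Hi Hj Hk Ha Hb Hc (x & _ & y & _ & Hx & Hy & H).
    set (Q := fun i => _) in Ha.
    assert (Hp : forall x y n, pair M x y < n -> x < n /\ y < n).
    { intros u v m Hm. split; eapply (leq_less_trans HM); try exact Hm.
      - apply (pair_left_leq HM).
      - apply (pair_right_leq HM). }
    assert (H1 : forall u v, bit M Q (pair M u v) 1 -> A u v).
    { intros u v [(_ & u' & _ & v' & _ & He & H') | (He & _)].
      - apply (pair_inj HM) in He. now destruct He as (-> & ->).
      - now apply (one_neq_zero HM) in He. }
    assert (H0 : forall u v, bit M Q (pair M u v) 0 -> ~ A u v).
    { intros u v [(He & _) | (_ & H')] HA'.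
      - symmetry in He. now apply (one_neq_zero HM) in He.
      - apply H'. exists u. split; [apply (pair_left_leq HM)|].
        exists v. split; [apply (pair_right_leq HM)|]. auto. }
    destruct H as [(HX & HY) | [(HX & HY & Hne) | [(HX & HR) | (HX & z & _ & Hz & HY & HZ)]]];
      apply (pair_inj HM) in HX; destruct HX as (-> & ->); apply Hp in Hi;
      destruct Hi as (Hxn & Hyn).
    + apply (pair_inj HM) in HY; destruct HY as (-> & ->).
      destruct (Htot x y) as [HA' | HA']; auto; [now apply (H0 x y) | now apply (H0 y x)].
    + apply (pair_inj HM) in HY; destruct HY as (-> & ->).
      apply Hne, Hanti; auto.
    + apply (H0 x y); auto.
    + apply (pair_inj HM) in HY; destruct HY as (-> & ->).
      apply (pair_inj HM) in HZ; destruct HZ as (-> & ->).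
      apply Hp in Hj. destruct Hj as (_ & Hzn).
      apply (H0 x z Hc). apply (Htrans x y z); auto.
  - assert (Hbit1 : forall i, i \in X -> bit M (fun i => i \in X) i 1) by (unfold bit; auto).
    assert (Hbit0 : forall i, ~ i \in X -> bit M (fun i => i \in X) i 0) by (unfold bit; auto).
    destruct (@Delta0_comprehension _ HM (fun i => i \in X /\ exists x, x < i + 1 /\
      exists y, y < i + 1 /\ (x \in L /\ y \in L /\ i = pair M x y))) as (RL & HRL); [delta0|].
    assert (Hholds : forall x y, holds M RL x y <-> x \in L /\ y \in L /\ pair M x y \in X).
    { intros x y. unfold holds. rewrite HRL. split.
      - intros (Hi & x' & _ & y' & _ & Hx & Hy & He). apply (pair_inj HM) in He.
        now destruct He as (-> & ->).
      - intros (Hx & Hy & Hi). split; [easy|].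
        exists x. split; [apply (pair_left_leq HM)|].
        exists y. split; [apply (pair_right_leq HM)|]. auto. }
    assert (Htot : forall x y, x \in L -> y \in L -> holds M RL x y \/ holds M RL y x).
    { intros x y Hx Hy. rewrite !Hholds.
      apply NNPP. intros HN.
      (* A constraint on fewer than three literals is invoked with one of them repeated. *)
      apply (HX (pair M x y) (pair M y x) (pair M y x) 0 0 0); try (apply Hbit0; tauto).
      exists x. split; [apply Hpp|]. exists y. split; [apply Hpp|]. auto. }
    exists RL. split; [split; [split|]|].
    + intros i Hi. apply HRL in Hi. destruct Hi as (_ & x & _ & y & _ & Hx & Hy & ->).
      now exists x, y.
    + intros x Hx. destruct (Htot x x Hx Hx); easy.
    + intros x y z Hx Hy Hz Hxy Hyz. apply Hholds in Hxy, Hyz. apply Hholds.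
      split; [easy|]. split; [easy|]. apply NNPP. intros HN.
      apply (HX (pair M x y) (pair M y z) (pair M x z) 1 1 0);
        try (apply Hbit0; tauto); try (apply Hbit1; tauto).
      exists x. split; [apply Hpp|]. exists y. split; [apply Hpp|].
      do 2 (split; [easy|]). do 3 right. split; [easy|].
      exists z. split; [apply Hpp|]. auto.
    + intros x y Hx Hy Hxy Hyx. apply Hholds in Hxy, Hyx. apply NNPP. intros HN.
      apply (HX (pair M x y) (pair M y x) (pair M y x) 1 1 1); try (apply Hbit1; tauto).
      exists x. split; [apply Hpp|]. exists y. split; [apply Hpp|]. auto 8.
    + exact Htot.
    + intros x y Hx Hy HR. apply Hholds. split; [easy|]. split; [easy|].
      apply NNPP. intros HN.
      apply (HX (pair M x y) (pair M x y) (pair M x y) 0 0 0); try (apply Hbit0; tauto).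
      exists x. split; [apply Hpp|]. exists y. split; [apply Hpp|]. auto 8.
Qed.

End Compactness.

#[local] Hint Extern 1 (Delta0 _ (fun e => holds _ _ _ _)) =>
  apply Delta0_mem; polynomial : delta0.
#[local] Hint Extern 1 (Delta0 _ (fun e => strict _ _ _ _)) =>
  unfold strict, holds; delta0 : delta0.

(** * Linear orders from strict weak orders *)

Section Weak_orders.
Variable M : L2_structure.
Hypothesis HM : RCA0 M.

(** [S] is to be a strict weak order, cotransitivity being transitivity of its negation;
    incomparable elements are then ordered as numbers. *)
Definition refine_order (S : num M -> num M -> Prop) (p q : num M) : Prop :=
  S p q \/ (~ S q p /\ p < q + 1).

Variables (P : set M) (S : num M -> num M -> Prop).
Hypothesis S_asym : forall p q, p \in P -> q \in P -> S p q -> ~ S q p.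
Hypothesis S_cotrans : forall p q r, S p r -> S p q \/ S q r.

Lemma refine_order_total p q : refine_order S p q \/ refine_order S q p.
Proof.
  unfold refine_order.
  destruct (classic (S p q)), (classic (S q p)); try tauto.
  destruct (less_trichotomy HM p q) as [H1 | [-> | H1]].
  - left. right. auto using less_leq.
  - left. right. auto using less_succ_diag.
  - right. right. auto using less_leq.
Qed.

Lemma refine_order_antisym p q : p \in P -> q \in P ->
  refine_order S p q -> refine_order S q p -> p = q.
Proof.
  intros Hp Hq [H | (H & Hl)] [H' | (H' & Hl')]; try contradiction.
  - now apply S_asym in H.
  - apply (less_succ_iff HM) in Hl. destruct Hl as [Hl | ->]; [|easy].
    apply (not_less HM) in Hl'. contradiction.
Qed.

Lemma refine_order_trans p q r : p \in P -> q \in P -> r \in P ->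
  refine_order S p q -> refine_order S q r -> refine_order S p r.
Proof.
  unfold refine_order. intros Hp Hq Hr [H | (H & Hl)] [H' | (H' & Hl')].
  - left. destruct (S_cotrans r H); [easy|]. now apply S_asym in H'.
  - left. destruct (S_cotrans r H); [easy|]. contradiction.
  - left. destruct (S_cotrans p H'); [contradiction | easy].
  - right. split; [|exact (leq_trans HM Hl Hl')].
    intros H''. destruct (S_cotrans q H''); contradiction.
Qed.

End Weak_orders.

(** * Left and right endpoints and their linear extensions *)

Section Approximations.
Variable M : L2_structure.
Hypothesis HM : RCA0 M.
Variables P R : set M.
Hypothesis HP : partial_order M P R.
Hypothesis H22 : no_2plus2 M P R.

Local Notation lt := (strict M R).

Lemma strict_irrefl p : ~ lt p p.
Proof. intros [_ H]. now apply H. Qed.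

Lemma strict_trans p q r : p \in P -> q \in P -> r \in P -> lt p q -> lt q r -> lt p r.
Proof.
  intros Hp Hq Hr [Hpq Hne] [Hqr Hne']. split.
  - now apply (po_trans HP) with q.
  - intros ->. apply Hne. now apply (po_antisym HP).
Qed.

Lemma strict_no_2plus2 p q p' q' : p \in P -> q \in P -> p' \in P -> q' \in P ->
  lt p q -> lt p' q' -> lt p q' \/ lt p' q.
Proof.
  intros Hp Hq Hp' Hq' H H'.
  destruct (classic (p = q')) as [-> | Hne].
  - right. now apply strict_trans with q'.
  - destruct (classic (p' = q)) as [-> | Hne'].
    + left. now apply strict_trans with q.
    + destruct (H22 Hp Hq Hp' Hq' H H'); [left | right]; split; auto.
Qed.

Definition fewer_below (n p q : num M) : Prop :=
  exists r, r < n /\ (r \in P /\ lt r q /\ ~ lt r p).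

Definition more_above (n p q : num M) : Prop :=
  exists r, r < n /\ (r \in P /\ lt p r /\ ~ lt q r).

(** Sets of predecessors form a chain under inclusion: witnesses of a difference in either direction
    would yield a copy of 2 + 2. *)
Lemma fewer_below_asym n p q : p \in P -> q \in P ->
  fewer_below n p q -> ~ fewer_below n q p.
Proof.
  intros Hp Hq (r & _ & Hr & H1 & H2) (s & _ & Hs & H3 & H4).
  destruct (strict_no_2plus2 Hr Hq Hs Hp H1 H3); contradiction.
Qed.

Lemma more_above_asym n p q : p \in P -> q \in P ->
  more_above n p q -> ~ more_above n q p.
Proof.
  intros Hp Hq (r & _ & Hr & H1 & H2) (s & _ & Hs & H3 & H4).
  destruct (strict_no_2plus2 Hp Hr Hq Hs H1 H3); contradiction.
Qed.

Lemma fewer_below_cotrans n p q r :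
  fewer_below n p r -> fewer_below n p q \/ fewer_below n q r.
Proof.
  intros (s & Hn & Hs & H1 & H2). destruct (classic (lt s q)); [left | right];
    exists s; auto.
Qed.

Lemma more_above_cotrans n p q r :
  more_above n p r -> more_above n p q \/ more_above n q r.
Proof.
  intros (s & Hn & Hs & H1 & H2). destruct (classic (lt q s)); [right | left];
    exists s; auto.
Qed.

(** The pairs (p, 0) and (p, 1) are to become the left and right endpoints of
    the interval of p.  Only the comparisons between a left and a right endpoint
    are prescribed; two endpoints on the same side can be separated by an
    endpoint on the other side, and [endpoint_order] breaks the remaining ties,
    as seen below n, by number. *)
Definition forced (x y : num M) : Prop :=
  exists p, p < x + 1 /\ exists q, q < y + 1 /\ (p \in P /\ q \in P /\
    ((x = pair M p 1 /\ y = pair M q 0 /\ lt p q) \/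
     (x = pair M p 0 /\ y = pair M q 1 /\ ~ lt q p))).

Definition endpoint_order (n x y : num M) : Prop :=
  exists p, p < x + 1 /\ exists q, q < y + 1 /\ (p \in P /\ q \in P /\
    ((x = pair M p 1 /\ y = pair M q 0 /\ lt p q) \/
     (x = pair M p 0 /\ y = pair M q 1 /\ ~ lt q p) \/
     (x = pair M p 0 /\ y = pair M q 0 /\ refine_order M (fewer_below n) p q) \/
     (x = pair M p 1 /\ y = pair M q 1 /\ refine_order M (more_above n) p q))).

Lemma Delta0_forced : Delta0 M (fun e => forced (e O) (e 1%nat)).
Proof. unfold forced. delta0. Qed.

Lemma Delta0_endpoint_order n : Delta0 M (fun e => endpoint_order n (e O) (e 1%nat)).
Proof. unfold endpoint_order, refine_order, fewer_below, more_above. delta0. Qed.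

Definition endpoint (x : num M) : Prop :=
  exists p, p < x + 1 /\ (p \in P /\ (x = pair M p 0 \/ x = pair M p 1)).

Ltac endpoints :=
  repeat match goal with
  | H : pair M _ _ = pair M _ _ |- _ =>
      apply (pair_inj HM) in H; destruct H; subst
  | H : @zero _ = @one _ |- _ => symmetry in H; now apply (one_neq_zero HM) in H
  | H : @one _ = @zero _ |- _ => now apply (one_neq_zero HM) in H
  end.

Lemma endpoint_order_00 n p q : endpoint_order n (pair M p 0) (pair M q 0) <->
  p \in P /\ q \in P /\ refine_order M (fewer_below n) p q.
Proof.
  split.
  - intros (p' & _ & q' & _ & Hp & Hq & H).
    intuition idtac; endpoints; auto.
  - intros (Hp & Hq & H). exists p. split; [apply (pair_left_leq HM)|].
    exists q. split; [apply (pair_left_leq HM)|]. auto 8.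
Qed.

Lemma endpoint_order_11 n p q : endpoint_order n (pair M p 1) (pair M q 1) <->
  p \in P /\ q \in P /\ refine_order M (more_above n) p q.
Proof.
  split.
  - intros (p' & _ & q' & _ & Hp & Hq & H).
    intuition idtac; endpoints; auto.
  - intros (Hp & Hq & H). exists p. split; [apply (pair_left_leq HM)|].
    exists q. split; [apply (pair_left_leq HM)|]. auto 8.
Qed.

Lemma endpoint_order_01 n p q : endpoint_order n (pair M p 0) (pair M q 1) <->
  p \in P /\ q \in P /\ ~ lt q p.
Proof.
  split.
  - intros (p' & _ & q' & _ & Hp & Hq & H).
    intuition idtac; endpoints; auto.
  - intros (Hp & Hq & H). exists p. split; [apply (pair_left_leq HM)|].
    exists q. split; [apply (pair_left_leq HM)|]. auto 8.
Qed.

Lemma endpoint_order_10 n p q : endpoint_order n (pair M p 1) (pair M q 0) <->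
  p \in P /\ q \in P /\ lt p q.
Proof.
  split.
  - intros (p' & _ & q' & _ & Hp & Hq & H).
    intuition idtac; endpoints; auto.
  - intros (Hp & Hq & H). exists p. split; [apply (pair_left_leq HM)|].
    exists q. split; [apply (pair_left_leq HM)|]. auto 8.
Qed.

Lemma endpoint_order_total n x y : endpoint x -> endpoint y ->
  endpoint_order n x y \/ endpoint_order n y x.
Proof.
  intros (p & _ & Hp & [-> | ->]) (q & _ & Hq & [-> | ->]);
    rewrite ?endpoint_order_00, ?endpoint_order_01, ?endpoint_order_10, ?endpoint_order_11;
    [ destruct (refine_order_total HM (fewer_below n) p q) | destruct (classic (lt q p))
    | destruct (classic (lt p q))
    | destruct (refine_order_total HM (more_above n) p q) ]; tauto.
Qed.

Lemma endpoint_order_antisym n x y : endpoint x -> endpoint y ->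
  endpoint_order n x y -> endpoint_order n y x -> x = y.
Proof.
  intros (p & _ & Hp & [-> | ->]) (q & _ & Hq & [-> | ->]);
    rewrite ?endpoint_order_00, ?endpoint_order_01, ?endpoint_order_10, ?endpoint_order_11;
    try tauto; intros (_ & _ & H) (_ & _ & H'); f_equal.
  - apply (@refine_order_antisym M HM P (fewer_below n)); auto using fewer_below_asym.
  - apply (@refine_order_antisym M HM P (more_above n)); auto using more_above_asym.
Qed.

(** Whenever endpoints of both sides are involved, one of p, q, r is itself a witness that two sets
    of predecessors, or of successors, differ. It is counted because it lies below n, which is why
    transitivity is claimed only there. *)
Lemma endpoint_order_trans n x y z : x < n -> y < n -> z < n ->
  endpoint x -> endpoint y -> endpoint z ->
  endpoint_order n x y -> endpoint_order n y z -> endpoint_order n x z.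
Proof.
  intros Hxn Hyn Hzn (p & Hpx & Hp & [-> | ->]) (q & Hqy & Hq & [-> | ->])
    (r & Hrz & Hr & [-> | ->]);
    pose proof (leq_less_trans HM Hpx Hxn) as Hpn;
    pose proof (leq_less_trans HM Hqy Hyn) as Hqn;
    pose proof (leq_less_trans HM Hrz Hzn) as Hrn;
    rewrite ?endpoint_order_00, ?endpoint_order_01, ?endpoint_order_10, ?endpoint_order_11;
    intros (_ & _ & H) (_ & _ & H'); (split; [easy | split; [easy|]]).
  - apply (@refine_order_trans M HM P (fewer_below n)) with q;
      auto using fewer_below_asym, fewer_below_cotrans.
  - intros Hrp. assert (HS : fewer_below n q p) by (exists r; auto).
    destruct H as [H | (H & _)]; [now apply fewer_below_asym in H | easy].
  - left. exists q. auto.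
  - intros Hrp. assert (HS : more_above n r q) by (exists p; auto).
    destruct H' as [H' | (H' & _)]; [now apply more_above_asym in H' | easy].
  - apply NNPP. intros Hpr. assert (HS : fewer_below n r q) by (exists p; auto).
    destruct H' as [H' | (H' & _)]; [now apply fewer_below_asym in H' | easy].
  - left. exists q. auto.
  - apply NNPP. intros Hpr. assert (HS : more_above n q p) by (exists r; auto).
    destruct H as [H | (H & _)]; [now apply more_above_asym in H | easy].
  - apply (@refine_order_trans M HM P (more_above n)) with q;
      auto using more_above_asym, more_above_cotrans.
Qed.

Lemma forced_endpoint_order n x y : forced x y -> endpoint_order n x y.
Proof.
  intros (p & Hpx & q & Hqy & Hp & Hq & H). exists p. split; [easy|].
  exists q. split; [easy|]. tauto.
Qed.

Lemma endpoints_linear_order (HW : weak_Konig_lemma M) : exists L RL,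
  linear_order M L RL /\
  (forall p, p \in P -> pair M p 0 \in L /\ pair M p 1 \in L) /\
  (forall p q, p \in P -> q \in P -> lt p q -> holds M RL (pair M p 1) (pair M q 0)) /\
  (forall p q, p \in P -> q \in P -> ~ lt q p -> holds M RL (pair M p 0) (pair M q 1)).
Proof.
  destruct (@Delta0_comprehension _ HM endpoint) as (L & HL); [unfold endpoint; delta0|].
  assert (HL01 : forall p, p \in P -> pair M p 0 \in L /\ pair M p 1 \in L).
  { intros p Hp. rewrite !HL.
    split; exists p; (split; [apply (pair_left_leq HM) | auto]). }
  destruct (linear_extension HM HW L forced Delta0_forced) as (RL & HRL & Hext).
  - intros n. exists (endpoint_order n). split; [apply Delta0_endpoint_order|].
    setoid_rewrite HL. split; [|split; [|split]].
    + intros x y _ _. apply endpoint_order_total.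
    + intros x y _ _. apply endpoint_order_antisym.
    + apply endpoint_order_trans.
    + intros x y _ _ _ _. apply forced_endpoint_order.
  - exists L, RL. split; [easy|]. split; [easy|].
    split; intros p q Hp Hq H; destruct (HL01 p Hp), (HL01 q Hq); apply Hext; auto;
      (exists p; split; [apply (pair_left_leq HM)|]);
      (exists q; split; [apply (pair_left_leq HM)|]); auto 8.
Qed.

Lemma WKL_distinguishing : weak_Konig_lemma M -> distinguishing_interval_order M P R.
Proof.
  intros HW. split; [exact HP|].
  destruct (endpoints_linear_order HW) as (L & RL & HL & HL01 & H10 & H01).
  destruct (@Delta0_comprehension _ HM (fun z => exists p, p < z + 1 /\ (p \in P /\
    z = pair M p (pair M p 0)))) as (f0 & Hf0); [delta0|].
  destruct (@Delta0_comprehension _ HM (fun z => exists p, p < z + 1 /\ (p \in P /\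
    z = pair M p (pair M p 1)))) as (f1 & Hf1); [delta0|].
  assert (H0 : forall p x, holds M f0 p x <-> p \in P /\ x = pair M p 0).
  { intros p x. unfold holds. rewrite Hf0. split.
    - intros (p' & _ & Hp & He). now endpoints.
    - intros (Hp & ->). exists p. split; [apply (pair_left_leq HM) | auto]. }
  assert (H1 : forall p x, holds M f1 p x <-> p \in P /\ x = pair M p 1).
  { intros p x. unfold holds. rewrite Hf1. split.
    - intros (p' & _ & Hp & He). now endpoints.
    - intros (Hp & ->). exists p. split; [apply (pair_left_leq HM) | auto]. }
  exists L, RL, f0, f1. split; [split|].
  - exact HL.
  - split; [|split].
    + intros z Hz. apply Hf0 in Hz. destruct Hz as (p & _ & Hp & ->).
      exists p, (pair M p 0). split; [easy|]. split; [now apply HL01 | easy].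
    + intros p Hp. exists (pair M p 0). now apply H0.
    + intros p x y Hx Hy. apply H0 in Hx, Hy. destruct Hx as (_ & ->), Hy as (_ & ->). easy.
  - split; [|split].
    + intros z Hz. apply Hf1 in Hz. destruct Hz as (p & _ & Hp & ->).
      exists p, (pair M p 1). split; [easy|]. split; [now apply HL01 | easy].
    + intros p Hp. exists (pair M p 1). now apply H1.
    + intros p x y Hx Hy. apply H1 in Hx, Hy. destruct Hx as (_ & ->), Hy as (_ & ->). easy.
  - intros p a b Hp Ha Hb. apply H0 in Ha. apply H1 in Hb.
    destruct Ha as (_ & ->), Hb as (_ & ->). apply H01; auto. apply strict_irrefl.
  - intros p q b a Hp Hq Hb Ha. apply H0 in Ha. apply H1 in Hb.
    destruct Ha as (_ & ->), Hb as (_ & ->). split.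
    + intros H. split; [now apply H10|]. intros He. endpoints.
    (* If p < q fails, the left endpoint of q is placed below the right endpoint of p, and
       antisymmetry makes the two equal. *)
    + intros (H & Hne). apply NNPP. intros HN. apply Hne.
      apply (po_antisym (proj1 HL)); [now apply HL01 | now apply HL01 | easy |].
      now apply H01.
  - intros i j p q x y Hp Hq Hx Hy Hd He.
    destruct i, j; try apply H0 in Hx; try apply H0 in Hy; try apply H1 in Hx;
      try apply H1 in Hy; destruct Hx as (_ & ->), Hy as (_ & ->); endpoints;
      destruct Hd; congruence.
Qed.

Lemma WKL_one_one : weak_Konig_lemma M -> one_one_interval_order M P R.
Proof.
  intros HW. split; [exact HP|].
  destruct (endpoints_linear_order HW) as (L & RL & HL & HL01 & H10 & H01).
  pose proof (po_trans (proj1 HL)) as Htrans.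
  assert (Hpp : forall p, p \in P -> holds M RL (pair M p 0) (pair M p 1)).
  { intros p Hp. apply H01; auto. apply strict_irrefl. }
  (* F(p) is the closed interval between the endpoints of p; its least element, the left endpoint,
     already determines p. *)
  destruct (@Delta0_comprehension _ HM (fun z => exists p, p < z + 1 /\ exists x, x < z + 1 /\
    (p \in P /\ x \in L /\ z = pair M p x /\ holds M RL (pair M p 0) x /\
     holds M RL x (pair M p 1)))) as (F & HF); [delta0|].
  assert (H : forall p x, holds M F p x <-> p \in P /\ x \in L /\
    holds M RL (pair M p 0) x /\ holds M RL x (pair M p 1)).
  { intros p x. unfold holds at 1. rewrite HF. split.
    - intros (p' & _ & x' & _ & Hp & Hx & He & H). now endpoints.
    - intros (Hp & Hx & H). exists p. split; [apply (pair_left_leq HM)|].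
      exists x. split; [apply (pair_right_leq HM) | auto]. }
  assert (Hends : forall p, p \in P -> holds M F p (pair M p 0) /\ holds M F p (pair M p 1)).
  { intros p Hp. destruct (HL01 p Hp). rewrite !H.
    split; (split; [easy|]); (split; [easy|]); split; auto; now apply (po_refl (proj1 HL)). }
  exists L, RL, F. split; [split|].
  - exact HL.
  - intros z Hz. apply HF in Hz. destruct Hz as (p & _ & x & _ & Hp & Hx & -> & _).
    now exists p, x.
  - intros p Hp. exists (pair M p 0). now apply Hends.
  - intros p x y z Hp Hx Hy Hz Hpx Hpz Hxy Hyz. apply H in Hpx, Hpz. apply H.
    destruct (HL01 p Hp). destruct Hpx as (_ & _ & Hpx & _), Hpz as (_ & _ & _ & Hpz).
    split; [easy|]. split; [easy|].
    split; [apply Htrans with x; auto | apply Htrans with z; auto].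
  - intros p q Hp Hq. destruct (HL01 p Hp) as (Hp0 & Hp1), (HL01 q Hq) as (Hq0 & Hq1). split.
    + intros Hpq x y Hx Hy. apply H in Hx, Hy.
      destruct Hx as (_ & HxL & _ & Hx), Hy as (_ & HyL & Hy & _).
      pose proof (H10 p q Hp Hq Hpq) as Hpq'.
      assert (Hqx : holds M RL (pair M p 1) y) by (apply Htrans with (pair M q 0); auto).
      split; [apply Htrans with (pair M p 1); auto|].
      intros ->. assert (He : pair M p 1 = pair M q 0).
      { apply (po_antisym (proj1 HL)); auto. apply Htrans with y; auto. }
      endpoints.
    + intros Hall. apply NNPP. intros HN.
      destruct (Hall (pair M p 1) (pair M q 0)) as (Hle & Hne); [now apply Hends..|].
      apply Hne, (po_antisym (proj1 HL)); auto.
  - intros p q Hp Hq Hne HFF. destruct (HL01 p Hp), (HL01 q Hq).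
    assert (He : pair M p 0 = pair M q 0).
    { apply (po_antisym (proj1 HL)); auto.
      - destruct (Hends q Hq) as (Hq0 & _). apply HFF, H in Hq0. tauto.
      - destruct (Hends p Hp) as (Hp0 & _). apply HFF, H in Hp0. tauto. }
    now endpoints.
Qed.
End Approximations.

(** * Weak König's lemma from separation *)

Section Separation.
Variable M : L2_structure.
Hypothesis HM : RCA0 M.

Lemma Pi1_induct (P : num M -> Prop) :
  Sigma1 M (fun e => ~ P (e O)) ->
  P 0 -> (forall n, P n -> P (n + 1)) -> forall n, P n.
Proof.
  intros (Q & HQ & HPQ) H0 HS c. apply NNPP. intros Hc.
  assert (HP : forall n, ~ P n <-> exists k, Q k (fun _ => n))
    by (intros n; apply (HPQ (fun _ => n))).
  assert (HQ' : Delta0 M (fun e => Q (e O) (fun _ => e 1%nat))).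
  { now apply (Delta0_rename (fun n => match n with O => O | _ => 1%nat end)
      (fun e n => match n with O => e O | S _ => e 1%nat end) HQ); intros e [|n]. }
  set (Q' := fun k n => Q k (fun _ => n)). change (Delta0 M (fun e => Q' (e O) (e 1%nat))) in HQ'.
  (* The failure at [c] is propagated down to [c - x] for all [x]. *)
  assert (H : forall x, exists k, exists y, y < c + 1 /\ (y + x = c /\ Q' k y)).
  { intros x. revert x.
    apply (@Sigma1_induct _ HM (fun x => exists k, exists y, y < c + 1 /\ (y + x = c /\ Q' k y))).
    - apply Sigma1_ex_Delta0. delta0.
    - apply HP in Hc. destruct Hc as (k & Hk). exists k, c.
      split; [apply (less_succ_diag HM)|]. split; [|easy].
      now rewrite (plus_comm HM), (zero_plus HM).
    - intros x (k & y & Hy & He & Hk).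
      assert (Hny : ~ P y) by (apply HP; now exists k).
      destruct (zero_or_succ HM y) as [-> | (y' & ->)]; [contradiction|].
      assert (Hny' : ~ P y') by auto. apply HP in Hny'. destruct Hny' as (k' & Hk').
      exists k', y'. split; [|split; [|easy]].
      + apply (less_trans HM) with (y' + 1); [apply (less_succ_diag HM) | easy].
      + rewrite <- He, <- !(plus_assoc HM). f_equal. apply (plus_comm HM). }
  destruct (H (c + 1)) as (k & y & _ & He & _).
  apply (less_irrefl HM (n := c)). apply (less_intro HM _ y). rewrite <- He at 1.
  now rewrite (plus_assoc HM), (plus_comm HM y).
Qed.

(** Witnesses for [U] and [V] are searched for in parallel, and the first one found decides n, a tie
    going to [U]. Membership is then Sigma1, and so is its negation. *)
Lemma decide (U V : num M -> num M -> Prop) :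
  Delta0 M (fun e => U (e O) (e 1%nat)) -> Delta0 M (fun e => V (e O) (e 1%nat)) ->
  (forall n, exists x, U x n \/ V x n) ->
  exists X, forall n, (n \in X -> exists x, U x n) /\ (~ n \in X -> exists x, V x n).
Proof.
  intros HU HV H.
  assert (Hl : forall n, exists x, (U x n \/ V x n) /\ forall y, y < x -> ~ (U y n \/ V y n)).
  { intros n. apply (least HM (fun x => U x n \/ V x n)); [delta0 | apply H]. }
  set (P := fun n => exists x, U x n /\ forall y, y < x -> ~ V y n).
  assert (HN : forall n, ~ P n <-> exists x, V x n /\ forall y, y < x + 1 -> ~ U y n).
  { intros n. split.
    - intros HP. destruct (Hl n) as (x & [Hx | Hx] & Hmin).
      + exfalso. apply HP. exists x. split; [easy|]. intros y Hy HVy. apply (Hmin y Hy). auto.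
      + exists x. split; [easy|]. intros y Hy HUy. apply (less_succ_iff HM) in Hy.
        destruct Hy as [Hy | ->]; [apply (Hmin y Hy); auto|].
        apply HP. exists x. split; [easy|]. intros y Hy HVy. apply (Hmin y Hy). auto.
    - intros (x & Hx & Hmin) (y & Hy & Hmin').
      destruct (classic (x < y)) as [Hxy | Hxy]; [now apply (Hmin' x)|].
      apply (not_less HM) in Hxy. now apply (Hmin y). }
  destruct (@comprehension _ HM P) as (X & HX).
  - unfold P. apply Sigma1_ex_Delta0. delta0.
  - apply Sigma1_ext with (P := fun e => exists x, V x (e O) /\ forall y, y < x + 1 -> ~ U y (e O)).
    + intros e. symmetry. apply HN.
    + apply Sigma1_ex_Delta0. delta0.
  - exists X. intros n. rewrite HX. split.
    + intros (x & Hx & _). now exists x.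
    + intros HP. apply HN in HP. destruct HP as (x & Hx & _). now exists x.
Qed.

(** A pair (n, s) records that n is enumerated at stage s, so A and B stand for the Sigma1 sets of
    their first components. *)
Definition separation : Prop := forall A B : set M,
  (forall n s t, holds M A n s -> ~ holds M B n t) ->
  exists X, forall n s, (holds M A n s -> n \in X) /\ (holds M B n s -> ~ n \in X).

(** For codes of binary sequences this is the initial segment relation. *)
Definition subcode (s t : num M) : Prop := forall x, x < s -> code_mem M s x -> code_mem M t x.

Lemma subcode_mem s t x : subcode s t -> code_mem M s x -> code_mem M t x.
Proof. intros H Hx. apply H; [now apply (code_mem_less HM) | easy]. Qed.

Lemma Delta0_subcode s t : polynomial M s -> polynomial M t ->
  Delta0 M (fun e => subcode (s e) (t e)).
Proof. apply (Delta0_at2 HM subcode). unfold subcode. delta0. Qed.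

Lemma binary_seq_value s l i : binary_seq M s l -> i < l ->
  exists b, code_mem M s (pair M i b) /\ (b = 0 \/ b = 1).
Proof.
  intros Hs Hi. pose proof Hs as (_ & _ & H & _). destruct (H i Hi) as (b & Hb).
  exists b. split; [easy|]. now apply (binary_seq_index HM Hs Hb).
Qed.

Lemma binary_seq_functional s l i b c : binary_seq M s l ->
  code_mem M s (pair M i b) -> code_mem M s (pair M i c) -> b = c.
Proof. intros (_ & _ & _ & H). apply H. Qed.

Arguments binary_seq_functional [s l i b c].

Lemma binary_seq_subcode s l t : binary_seq M s l ->
  (forall i b, code_mem M s (pair M i b) -> code_mem M t (pair M i b)) -> subcode s t.
Proof.
  intros (_ & H & _) Ht x _ Hx. destruct (H x Hx) as (i & b & _ & _ & ->). auto.
Qed.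

Arguments binary_seq_subcode [s l t].

Lemma binary_seq_extend s n (Q : Prop) : binary_seq M s n ->
  exists s', binary_seq M s' (n + 1) /\ subcode s s' /\
    (code_mem M s' (pair M n 0) <-> Q).
Proof.
  intros Hs.
  assert (H : exists s', binary_seq M s' (n + 1) /\ forall i b,
    code_mem M s' (pair M i b) <->
    i < n + 1 /\ bit M (fun i => code_mem M s (pair M i 1) \/ (i = n /\ ~ Q)) i b).
  (* [Q] is a fixed truth value; once it is decided classically, the new sequence has a Delta0
     definition. *)
  { destruct (classic Q) as [HQ | HQ].
    - destruct (binary_seq_exists HM (fun i => code_mem M s (pair M i 1)) (n + 1))
        as (s' & Hs' & H); [delta0|].
      exists s'. split; [easy|]. intros i b. rewrite H. unfold bit. tauto.
    - destruct (binary_seq_exists HM (fun i => code_mem M s (pair M i 1) \/ i = n) (n + 1))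
        as (s' & Hs' & H); [delta0|].
      exists s'. split; [easy|]. intros i b. rewrite H. unfold bit. tauto. }
  destruct H as (s' & Hs' & H). exists s'. split; [easy|]. split.
  - apply (binary_seq_subcode Hs). intros i b Hi. apply H.
    destruct (binary_seq_index HM Hs Hi) as (Hin & Hb).
    split; [now apply (less_leq HM)|]. unfold bit.
    destruct Hb as [-> | ->]; [right | left; auto]. split; [easy|].
    intros [H1 | (-> & _)]; [|now apply (less_irrefl HM) in Hin].
    apply (one_neq_zero HM). exact (binary_seq_functional Hs H1 Hi).
  - rewrite H. unfold bit. split.
    + intros (_ & [(He & _) | (_ & HN)]); [|tauto].
      symmetry in He. now apply (one_neq_zero HM) in He.
    + intros HQ. split; [apply (less_succ_diag HM)|]. right. split; [easy|].
      intros [H1 | H1]; [|tauto]. apply (binary_seq_index HM Hs) in H1.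
      now apply (less_irrefl HM (n := n)).
Qed.

End Separation.

Arguments binary_seq_functional [M s l i b c].
Arguments binary_seq_subcode [M s l t].
Arguments subcode_mem [M] HM [s t x].
Arguments binary_seq_value [M] HM [s l i].
Arguments binary_seq_extend [M] HM [s n].

#[local] Hint Extern 1 (Delta0 _ (fun e => subcode _ _ _)) =>
  apply Delta0_subcode; [assumption | polynomial | polynomial] : delta0.

(** * A path through an infinite tree from a separating set *)

Section Tree.
Variable M : L2_structure.
Hypothesis HM : RCA0 M.
Variable T : set M.
Hypothesis HT : binary_tree M T.

(** The child of s with last bit c is still alive at level n; l is the length of s, hence the place
    of that bit. *)
Definition extendible (c s n : num M) : Prop :=
  exists t, t \in T /\ binary_seq M t n /\ subcode M s t /\
    exists l, l < s + 1 /\ (binary_seq M s l /\ code_mem M t (pair M l c)).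

(** The codes of all sequences of length n lie below a number that can be found by search, so the
    absence of an extension at level n is Sigma1 as well. *)
Lemma extendible_set c : exists X, forall s n, holds M X s n <-> extendible c s n.
Proof.
  destruct (@comprehension _ HM (fun z => exists s n, z = pair M s n /\ extendible c s n))
    as (X & HX).
  - apply Sigma1_ext with (P := fun e => exists t, exists s, s < e O + 1 /\
      exists n, n < e O + 1 /\ (e O = pair M s n /\ (t \in T /\ binary_seq M t n /\
      subcode M s t /\ exists l, l < s + 1 /\ (binary_seq M s l /\ code_mem M t (pair M l c))))).
    + intros e. split.
      * intros (t & s & _ & n & _ & He & H). exists s, n. split; [easy|]. now exists t.
      * intros (s & n & -> & t & H). exists t, s. split; [apply (pair_left_leq HM)|].
        exists n. split; [apply (pair_right_leq HM) | auto].
    + apply Sigma1_ex_Delta0. delta0.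
  - apply Sigma1_ext with (P := fun e => exists k, forall s, s < e O + 1 ->
      forall n, n < e O + 1 -> e O = pair M s n -> code_bound M (pair M n 1) k /\
      forall t, t < k -> ~ (t \in T /\ binary_seq M t n /\ subcode M s t /\
        exists l, l < s + 1 /\ (binary_seq M s l /\ code_mem M t (pair M l c)))).
    + intros e. split.
      * intros (k & Hk) (s & n & He & t & Ht). rewrite He in Hk.
        destruct (Hk s (pair_left_leq HM s n) n (pair_right_leq HM s n) eq_refl) as (Hb & H).
        apply (H t); [|easy]. eapply binary_seq_less_bound; try eassumption. apply Ht.
      * intros HN. destruct (classic (exists s n, e O = pair M s n)) as [(s & n & He) | Hp].
        -- destruct (code_bound_exists HM (pair M n 1)) as (k & Hk). exists k.
           intros s' _ n' _ He'. rewrite He in He'. apply (pair_inj HM) in He'.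
           destruct He' as (<- & <-). split; [easy|]. intros t _ Ht. apply HN.
           exists s, n. split; [easy|]. now exists t.
        -- exists 0. intros s _ n _ He. exfalso. eauto.
    + apply Sigma1_ex_Delta0. delta0.
  - exists X. intros s n. unfold holds. rewrite HX. split.
    + intros (s' & n' & He & H). apply (pair_inj HM) in He. now destruct He as (-> & ->).
    + intros H. now exists s, n.
Qed.

Lemma restrict_in_tree t n m : t \in T -> binary_seq M t n -> m < n + 1 ->
  exists t', t' \in T /\ binary_seq M t' m /\
    forall i b, code_mem M t' (pair M i b) <-> i < m /\ code_mem M t (pair M i b).
Proof.
  intros Ht Hn Hm. destruct (binary_seq_restrict HM Hn Hm) as (t' & Ht' & H).
  exists t'. split; [|auto]. apply (proj2 HT t t' m Ht Ht'). intros x Hx.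
  pose proof Ht' as (_ & Hp & _). destruct (Hp x Hx) as (i & b & _ & _ & ->).
  now apply H.
Qed.

Arguments restrict_in_tree [t n m].

Lemma extendible_less c s n l : extendible c s n -> binary_seq M s l -> l < n.
Proof.
  intros (t & _ & Ht & _ & l' & _ & Hl' & Hc) Hl.
  rewrite (binary_seq_length_unique HM Hl Hl').
  now apply (binary_seq_index HM Ht) in Hc.
Qed.

Arguments extendible_less [c s n l].

(** An extension at level n is truncated to level m. The hypothesis on c' supplies that s is shorter
    than m, so that the bit after s survives. *)
Lemma extendible_antitone c c' s n m :
  extendible c s n -> extendible c' s m -> m < n + 1 -> extendible c s m.
Proof.
  intros (t & Ht & Hn & Hst & l & Hls & Hl & Hc) Hm Hmn.
  pose proof (extendible_less Hm Hl) as Hlm.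
  destruct (restrict_in_tree Ht Hn Hmn) as (t' & Ht' & Hm' & H).
  exists t'. split; [easy|]. split; [easy|]. split.
  - apply (binary_seq_subcode Hl). intros i b Hi. apply H.
    split; [|now apply (subcode_mem HM Hst)].
    apply (binary_seq_index HM Hl) in Hi. exact (less_trans HM (proj1 Hi) Hlm).
  - exists l. split; [easy|]. split; [easy|]. now apply H.
Qed.

Arguments extendible_antitone [c c' s n m].

(** [b] bounds the codes of the initial segments, to keep the quantifier over them
    bounded. *)
Definition follows (X : set M) (s n b : num M) : Prop :=
  binary_seq M s n /\ forall i, i < n -> exists u, u < b /\
    (binary_seq M u i /\ subcode M u s /\ (code_mem M s (pair M i 0) <-> u \in X)).

Ltac delta0_follows := unfold follows; delta0.

(** The bit at i is determined by the initial segment of length i, so agreement propagates from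
    place to place. *)
Lemma follows_agree X s n b s' n' b' : follows X s n b -> follows X s' n' b' ->
  forall i c, i < n -> i < n' -> code_mem M s (pair M i c) -> code_mem M s' (pair M i c).
Proof.
  intros [Hs Hf] [Hs' Hf'].
  enough (H : forall m i, i < m -> i < n -> i < n' -> forall c, c < 1 + 1 ->
    (code_mem M s (pair M i c) <-> code_mem M s' (pair M i c))).
  { intros i c Hi Hi' Hc. apply (H (i + 1) i); auto; [apply (less_succ_diag HM)|].
    apply (less_succ_iff HM). rewrite (less_one HM). apply (binary_seq_index HM Hs Hc). }
  intros m. revert m.
  apply (@Delta0_induct _ HM (fun m => forall i, i < m -> i < n -> i < n' -> forall c, c < 1 + 1 ->
    (code_mem M s (pair M i c) <-> code_mem M s' (pair M i c)))); [delta0| |].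
  { intros i Hi. now apply (num_not_less_zero HM) in Hi. }
  intros m IH i Him Hi Hi' c Hc.
  apply (less_succ_iff HM) in Him. destruct Him as [Him | ->]; [now apply IH|].
  destruct (Hf m Hi) as (u & _ & Hu & Hus & Hb), (Hf' m Hi') as (u' & _ & Hu' & Hus' & Hb').
  assert (He : u = u').
  { apply (binary_seq_ext HM Hu Hu'). intros i b0 Hib.
    destruct (binary_seq_index HM Hu Hib) as (Him & Hbit).
    destruct (binary_seq_value HM Hu' Him) as (b1 & Hb1 & _).
    replace b0 with b1; [easy|].
    apply (binary_seq_functional Hs' (i := i)); [now apply (subcode_mem HM Hus')|].
    apply IH; auto.
    - exact (less_trans HM Him Hi).
    - exact (less_trans HM Him Hi').
    - apply (less_succ_iff HM). now rewrite (less_one HM).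
    - now apply (subcode_mem HM Hus). }
  subst u'.
  destruct (binary_seq_value HM Hs Hi) as (c1 & Hc1 & Hbit1).
  destruct (binary_seq_value HM Hs' Hi') as (c2 & Hc2 & Hbit2).
  assert (Heq : c1 = c2).
  { destruct Hbit1 as [-> | ->], Hbit2 as [-> | ->]; auto.
    - apply (binary_seq_functional Hs' (i := m)); tauto.
    - apply (binary_seq_functional Hs (i := m)); tauto. }
  subst c2. split; intros Hmc.
  - now rewrite (binary_seq_functional Hs Hmc Hc1).
  - now rewrite (binary_seq_functional Hs' Hmc Hc2).
Qed.

Arguments follows_agree [X s n b s' n' b'].

Lemma follows_exists X n : exists s b, follows X s n b.
Proof.
  revert n. apply (@Sigma1_induct _ HM (fun n => exists s b, follows X s n b)).
  - apply (Sigma1_ex HM (fun s e => exists b, follows X s (e O) b)).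
    apply Sigma1_ex_Delta0. delta0_follows.
  - destruct (binary_seq_exists HM (fun i => i = 0) 0) as (s & Hs & _); [delta0|].
    exists s, 0. split; [easy|]. intros i Hi. now apply (num_not_less_zero HM) in Hi.
  - intros n (s & b & Hs & Hf).
    destruct (binary_seq_extend HM (s \in X) Hs) as (s' & Hs' & Hss' & H0).
    destruct (upper_bound HM s b) as (b' & Hsb & Hbb).
    exists s', b'. split; [easy|]. intros i Hi.
    apply (less_succ_iff HM) in Hi. destruct Hi as [Hi | ->].
    + destruct (Hf i Hi) as (u & Hub & Hu & Hus & Hiff).
      exists u. split; [exact (less_trans HM Hub Hbb)|]. split; [easy|]. split.
      * intros x _ Hx. apply (subcode_mem HM Hss'). now apply (subcode_mem HM Hus).
      * rewrite <- Hiff. split; [|apply (subcode_mem HM Hss')].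
        intros H. destruct (binary_seq_value HM Hs Hi) as (c & Hc & _).
        now rewrite (binary_seq_functional Hs' H (subcode_mem HM Hss' Hc)).
    + exists s. auto.
Qed.

(** The set is the union of all sequences that follow X. Since they agree, z is outside as soon as
    one of them of length greater than z omits it, so the complement is Sigma1. *)
Lemma follows_set X : exists g, forall z,
  z \in g <-> exists n s b, follows X s n b /\ code_mem M s z.
Proof.
  apply (comprehension HM).
  - apply (Sigma1_ex HM (fun n e => exists s b, follows X s n b /\ code_mem M s (e O))).
    apply (Sigma1_ex HM (fun s e => exists b, follows X s (e O) b /\ code_mem M s (e 1%nat))).
    apply Sigma1_ex_Delta0. delta0_follows.
  - apply Sigma1_ext with (P := fun e => exists n s b,
      e O < n /\ follows X s n b /\ ~ code_mem M s (e O)).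
    + intros e. split.
      * intros (n & s & b & Hn & Hs & Hz) (n' & s' & b' & Hs' & Hz'). apply Hz.
        pose proof Hs' as [(_ & Hp & _) _]. destruct (Hp _ Hz') as (i & c & Hi & _ & He).
        rewrite He in *. apply (follows_agree Hs' Hs); auto.
        exact (leq_less_trans HM (pair_left_leq HM i c) Hn).
      * intros H. destruct (follows_exists X (e O + 1)) as (s & b & Hs).
        exists (e O + 1), s, b. split; [apply (less_succ_diag HM)|]. split; [easy|].
        intros Hz. apply H. eauto.
    + apply (Sigma1_ex HM (fun n e => exists s b,
        e O < n /\ follows X s n b /\ ~ code_mem M s (e O))).
      apply (Sigma1_ex HM (fun s e => exists b, e 1%nat < e O /\ follows X s (e O) b /\
        ~ code_mem M s (e 1%nat))).
      apply Sigma1_ex_Delta0. delta0_follows.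
Qed.

Hypothesis Hinf : infinite M T.

(** Sequences shorter than n have codes below a common bound, so the tree has a node of length at
    least n, which is truncated to n. *)
Lemma infinite_tree_levels n : exists t, t \in T /\ binary_seq M t n.
Proof.
  destruct (code_bound_exists HM (pair M n 1)) as (k & Hk).
  destruct (Hinf k) as (x & Hx & Hxk).
  destruct (proj1 HT x Hx) as (l & Hl).
  destruct (classic (l < n)) as [Hln | Hln].
  - exfalso. apply Hxk. apply (code_less_bound HM Hk (proj1 Hl)). intros z Hz.
    pose proof Hl as (_ & Hp & _). destruct (Hp z Hz) as (i & c & Hi & Hc & ->).
    apply (pair_bit_less HM); [exact (less_trans HM Hi Hln) | easy].
  - destruct (restrict_in_tree (m := n) Hx Hl) as (t & Ht & Hn & _).
    + now apply (not_less HM).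
    + eauto.
Qed.

Variable X : set M.
Hypothesis HX0 : forall s n, extendible 0 s n -> ~ extendible 1 s n -> s \in X.
Hypothesis HX1 : forall s n, extendible 1 s n -> ~ extendible 0 s n -> ~ s \in X.

(** By induction the initial segment [u] of [s] extends to level m. If it did not do so through the
    bit chosen after [u], it would through the other bit only, and X would have been bound to choose
    that one. *)
Lemma follows_extendible n : forall m s b, n < m + 1 -> follows X s n b ->
  exists t, t \in T /\ binary_seq M t m /\ subcode M s t.
Proof.
  revert n.
  apply (@Pi1_induct _ HM (fun n => forall m s b, n < m + 1 -> follows X s n b ->
    exists t, t \in T /\ binary_seq M t m /\ subcode M s t)).
  (* A bound k on the codes of length m makes the search for t bounded, so the negation of the claim
     is Sigma1. *)
  - apply Sigma1_ext with (P := fun e => exists m s b k, e O < m + 1 /\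
      follows X s (e O) b /\ code_bound M (pair M m 1) k /\
      forall t, t < k -> ~ (t \in T /\ binary_seq M t m /\ subcode M s t)).
    + intros e. split.
      * intros (m & s & b & k & Hm & Hs & Hk & HN) H.
        destruct (H m s b Hm Hs) as (t & Ht). apply (HN t); [|easy].
        apply (binary_seq_less_bound HM (proj1 (proj2 Ht)) Hk).
      * intros H. apply NNPP. intros HN. apply H. intros m s b Hm Hs.
        apply NNPP. intros Ht. apply HN.
        destruct (code_bound_exists HM (pair M m 1)) as (k & Hk).
        exists m, s, b, k. repeat (split; [easy|]). intros t _ Ht'. apply Ht. now exists t.
    + apply (Sigma1_ex HM (fun m e => exists s b k, e O < m + 1 /\
        follows X s (e O) b /\ code_bound M (pair M m 1) k /\
        forall t, t < k -> ~ (t \in T /\ binary_seq M t m /\ subcode M s t))).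
      apply (Sigma1_ex HM (fun s e => exists b k, e 1%nat < e O + 1 /\
        follows X s (e 1%nat) b /\ code_bound M (pair M (e O) 1) k /\
        forall t, t < k -> ~ (t \in T /\ binary_seq M t (e O) /\ subcode M s t))).
      apply (Sigma1_ex HM (fun b e => exists k, e 2%nat < e 1%nat + 1 /\
        follows X (e O) (e 2%nat) b /\ code_bound M (pair M (e 1%nat) 1) k /\
        forall t, t < k -> ~ (t \in T /\ binary_seq M t (e 1%nat) /\ subcode M (e O) t))).
      apply Sigma1_ex_Delta0. delta0_follows.
  - intros m s b _ [Hs _]. destruct (infinite_tree_levels m) as (t & Ht & Hm).
    exists t. split; [easy|]. split; [easy|]. apply (binary_seq_subcode Hs).
    intros i c Hi. apply (binary_seq_index HM Hs) in Hi. destruct Hi as (Hi & _).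
    now apply (num_not_less_zero HM) in Hi.
  - intros n IH m s b Hnm [Hs Hf].
    destruct (Hf n (less_succ_diag HM n)) as (u & Hub & Hu & Hus & Hun).
    assert (Hmem : forall i c, i < n -> code_mem M s (pair M i c) -> code_mem M u (pair M i c)).
    { intros i c Hi Hc. destruct (binary_seq_value HM Hu Hi) as (c' & Hc' & _).
      now rewrite (binary_seq_functional Hs Hc (subcode_mem HM Hus Hc')). }
    assert (Hfu : follows X u n b).
    { split; [easy|]. intros i Hi.
      destruct (Hf i (less_leq HM Hi)) as (v & Hvb & Hv & Hvs & Hiff).
      exists v. split; [easy|]. split; [easy|]. split.
      - apply (binary_seq_subcode Hv). intros j c Hj.
        apply Hmem; [|now apply (subcode_mem HM Hvs)].
        apply (binary_seq_index HM Hv) in Hj. exact (less_trans HM (proj1 Hj) Hi).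
      - rewrite <- Hiff. split; [apply (subcode_mem HM Hus) | now apply Hmem]. }
    assert (Hnm' : n < m + 1).
    { exact (less_trans HM (less_succ_diag HM n) Hnm). }
    destruct (IH m u b Hnm' Hfu) as (t & Ht & Htm & Hut).
    assert (Hnlm : n < m).
    { apply (less_leq_trans HM (less_succ_diag HM n) Hnm). }
    destruct (binary_seq_value HM Htm Hnlm) as (c & Hc & Hcb).
    destruct (binary_seq_value HM Hs (less_succ_diag HM n)) as (d & Hd & Hdb).
    assert (Huc : extendible c u m).
    { exists t. split; [easy|]. split; [easy|]. split; [easy|]. exists n.
      split; [exact (binary_seq_length_leq HM Hu) | auto]. }
    assert (Hud : extendible d u m).
    { apply NNPP. intros HN.
      assert (Hd0 : d = 0 <-> u \in X).
      { rewrite <- Hun. split; [now intros <-|].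
        intros H0. exact (binary_seq_functional Hs Hd H0). }
      destruct Hcb as [-> | ->], Hdb as [-> | ->]; try contradiction.
      - apply (one_neq_zero HM), Hd0, (HX0 Huc HN).
      - apply (HX1 Huc HN). now apply Hd0. }
    destruct Hud as (t' & Ht' & Htm' & Hut' & l & _ & Hl & Hld).
    rewrite (binary_seq_length_unique HM Hl Hu) in Hld.
    exists t'. split; [easy|]. split; [easy|]. apply (binary_seq_subcode Hs).
    intros i c' Hi. pose proof (binary_seq_index HM Hs Hi) as (Hin & _).
    apply (less_succ_iff HM) in Hin. destruct Hin as [Hin | ->].
    + apply (subcode_mem HM Hut'). now apply Hmem.
    + now rewrite (binary_seq_functional Hs Hi Hd).
Qed.

Arguments follows_extendible [n m s b].

Lemma path_exists : exists g, path M T g.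
Proof.
  destruct (follows_set X) as (g & Hg). exists g.
  assert (Hgs : forall s n b i c, follows X s n b -> i < n ->
    (code_mem M s (pair M i c) <-> holds M g i c)).
  { intros s n b i c Hs Hi. unfold holds. rewrite Hg. split; [eauto 6|].
    intros (n' & s' & b' & Hs' & Hic).
    apply (follows_agree Hs' Hs); auto.
    now apply (binary_seq_index HM (proj1 Hs')) in Hic. }
  split; [|split; [|split]].
  - intros z Hz. apply Hg in Hz. destruct Hz as (n & s & b & [(_ & Hp & _) _] & Hz).
    destruct (Hp z Hz) as (i & c & _ & Hc & He). eauto.
  - intros i. destruct (follows_exists X (i + 1)) as (s & b & Hs).
    destruct (binary_seq_value HM (proj1 Hs) (less_succ_diag HM i)) as (c & Hc & _).
    exists c. apply (Hgs s (i + 1) b i c Hs (less_succ_diag HM i)). easy.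
  - intros i c d Hc Hd. destruct (follows_exists X (i + 1)) as (s & b & Hs).
    apply (Hgs s (i + 1) b i) in Hc, Hd; auto using less_succ_diag.
    exact (binary_seq_functional (proj1 Hs) Hc Hd).
  - intros n. destruct (follows_exists X n) as (s & b & Hs).
    destruct (follows_extendible (less_succ_diag HM n) Hs) as (t & Ht & Hn & Hst).
    exists s. split; [|split; [apply Hs | intros i c Hi; now apply (Hgs s n b)]].
    rewrite (binary_seq_ext HM (proj1 Hs) Hn); [easy|].
    intros i c. apply (subcode_mem HM Hst).
Qed.

End Tree.

Arguments extendible_antitone [M] HM [T] HT [c c' s n m].

Lemma separation_WKL (M : L2_structure) (HM : RCA0 M) : separation M -> weak_Konig_lemma M.
Proof.
  intros HS T HT Hinf.
  destruct (extendible_set HM T 0) as (E0 & HE0), (extendible_set HM T 1) as (E1 & HE1).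
  destruct (@Delta0_comprehension _ HM (fun z => z \in E0 /\ ~ z \in E1)) as (A & HA); [delta0|].
  destruct (@Delta0_comprehension _ HM (fun z => z \in E1 /\ ~ z \in E0)) as (B & HB); [delta0|].
  destruct (HS A B) as (X & HX).
  - intros s n m Hn Hm. apply HA in Hn. apply HB in Hm.
    destruct Hn as (Hn0 & Hn1), Hm as (Hm1 & Hm0).
    apply HE0 in Hn0. apply HE1 in Hm1.
    (* An extension at the later of the levels n and m restricts to the earlier one, so the two
       subtrees cannot each die before the other. *)
    destruct (classic (n < m + 1)) as [Hnm | Hnm].
    + apply Hn1, HE1. exact (extendible_antitone HM HT Hm1 Hn0 Hnm).
    + apply Hm0, HE0. apply (extendible_antitone HM HT Hn0 Hm1).
      apply (not_less HM) in Hnm. exact (less_trans HM (less_succ_diag HM m) Hnm).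
  - apply (path_exists HM HT Hinf X); intros s n H H'; apply (HX s n).
    + apply HA. split; [now apply HE0|]. intros HN. now apply H', HE1.
    + apply HB. split; [now apply HE1|]. intros HN. now apply H', HE0.
Qed.

(** * Separation from interval orders *)

Section Linear_orders.
Variable M : L2_structure.
Variables L RL : set M.
Hypothesis HL : linear_order M L RL.

Lemma linear_not_strict x y : x \in L -> y \in L -> ~ strict M RL x y -> holds M RL y x.
Proof.
  intros Hx Hy H. destruct (classic (x = y)) as [-> | Hne].
  - now apply (po_refl (proj1 HL)).
  - destruct (proj2 HL x y Hx Hy) as [H' | H']; [|easy]. exfalso. now apply H.
Qed.

Lemma leq_strict_trans x y z : x \in L -> y \in L -> z \in L ->
  holds M RL x y -> strict M RL y z -> strict M RL x z.
Proof.
  intros Hx Hy Hz Hxy [Hyz Hne]. split.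
  - now apply (po_trans (proj1 HL)) with y.
  - intros ->. apply Hne. now apply (po_antisym (proj1 HL)).
Qed.

Lemma strict_leq_trans x y z : x \in L -> y \in L -> z \in L ->
  strict M RL x y -> holds M RL y z -> strict M RL x z.
Proof.
  intros Hx Hy Hz [Hxy Hne] Hyz. split.
  - now apply (po_trans (proj1 HL)) with y.
  - intros ->. apply Hne. now apply (po_antisym (proj1 HL)).
Qed.

Variables P F : set M.

(** Transitivity and antisymmetry are inherited from the line, which spares a case analysis on the
    elements of the gadget. *)
Lemma partial_order_of_intervals R : subset_prod M R P P ->
  (forall p, p \in P -> holds M R p p) ->
  (forall p, p \in P -> exists x, holds M F p x) ->
  (forall p q, p \in P -> q \in P ->
    (strict M R p q <-> forall x y, holds M F p x -> holds M F q y -> strict M RL x y)) ->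
  (forall p x, holds M F p x -> x \in L) ->
  partial_order M P R.
Proof.
  intros HR Hrefl Hne Hlt HFL. split; [easy | easy | |].
  - intros p q r Hp Hq Hr Hpq Hqr.
    destruct (classic (p = q)) as [-> | Hnpq]; [easy|].
    destruct (classic (q = r)) as [<- | Hnqr]; [easy|].
    apply Hlt; auto. intros x z Hx Hz. destruct (Hne q Hq) as (y & Hy).
    apply leq_strict_trans with y; eauto.
    + apply (proj1 (Hlt p q Hp Hq)); [split|..]; auto.
    + apply (proj1 (Hlt q r Hq Hr)); [split|..]; auto.
  - intros p q Hp Hq Hpq Hqp. apply NNPP. intros Hnpq.
    destruct (Hne p Hp) as (x & Hx), (Hne q Hq) as (y & Hy).
    assert (Hxy : strict M RL x y) by (apply (proj1 (Hlt p q Hp Hq)); [split|..]; auto).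
    assert (Hyx : strict M RL y x) by (apply (proj1 (Hlt q p Hq Hp)); [split|..]; auto).
    apply (proj2 Hxy). apply (po_antisym (proj1 HL)); [eauto.. | apply Hxy | apply Hyx].
Qed.

End Linear_orders.

Lemma interval_rep_not_strict (M : L2_structure) (HM : RCA0 M) P R L RL F p q :
  interval_rep M P R L RL F -> p \in P -> q \in P -> ~ strict M R p q ->
  exists x y, holds M F p x /\ holds M F q y /\ holds M RL y x.
Proof.
  intros [HL Hsub _ _ Hord] Hp Hq Hpq. apply NNPP. intros HN. apply Hpq.
  apply (Hord p q Hp Hq). intros x y Hx Hy. apply NNPP. intros Hxy. apply HN.
  exists x, y. split; [easy|]. split; [easy|].
  apply (linear_not_strict HL); [eapply (subset_prod_holds HM); eassumption.. | easy].
Qed.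

Lemma interval_order_no_2plus2 (M : L2_structure) (HM : RCA0 M) P R :
  interval_order M P R -> no_2plus2 M P R.
Proof.
  intros (_ & L & RL & F & Hrep) p0 q0 p1 q1 Hp0 Hq0 Hp1 Hq1 H0 H1.
  pose proof Hrep as [HL Hsub _ _ Hord].
  assert (HFL : forall p x, holds M F p x -> x \in L).
  { intros p x Hx. apply (subset_prod_holds HM Hsub Hx). }
  apply NNPP. intros HN. apply not_or_and in HN. destruct HN as (HN0 & HN1).
  destruct (interval_rep_not_strict HM Hrep Hp0 Hq1 (fun H => HN0 (proj1 H)))
    as (x & y & Hx & Hy & Hyx).
  destruct (interval_rep_not_strict HM Hrep Hp1 Hq0 (fun H => HN1 (proj1 H)))
    as (x' & y' & Hx' & Hy' & Hyx').
  assert (Hxy' : strict M RL x y') by (apply (proj1 (Hord p0 q0 Hp0 Hq0)); auto).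
  assert (Hx'y : strict M RL x' y) by (apply (proj1 (Hord p1 q1 Hp1 Hq1)); auto).
  (* The four points form a cycle x < y' <= x' < y <= x. *)
  apply (@strict_irrefl M RL x).
  apply (strict_leq_trans HL) with y; eauto.
  apply (strict_leq_trans HL) with x'; eauto.
  - apply (strict_leq_trans HL) with y'; eauto.
  - apply Hx'y.
Qed.

(** The line of the gadget is divided into blocks, one for each n. A block runs through a Guard, the
    Left points, a Center and the Right points; Left and Right points are indexed by the stages at
    which n enters A or B. *)
Inductive tag : Set := Guard | Left | Center | Right.

Definition tag_less (t u : tag) : Prop :=
  match t, u with
  | Guard, (Left | Center | Right) | Left, (Center | Right) | Center, Right => True
  | _, _ => False
  end.

(** * Coding of the points and definability over them *)

Section Gadget.
Variable M : L2_structure.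
Hypothesis HM : RCA0 M.

Definition tag_code (t : tag) : num M :=
  match t with Guard => 0 | Left => 1 | Center => 1 + 1 | Right => 1 + 1 + 1 end.

Lemma tag_code_inj t u : tag_code t = tag_code u -> t = u.
Proof.
  assert (H : forall k, k + 1 <> (0 : num M)) by apply (succ_neq_zero (RCA0_basic HM)).
  assert (H0 : (1 : num M) <> 0) by apply (one_neq_zero HM).
  assert (Hs : forall k : num M, 1 = k + 1 -> k = 0).
  { intros k Hk. apply (plus_cancel HM 1). now rewrite <- Hk, (zero_plus HM). }
  destruct t, u; simpl; intros He; try reflexivity; exfalso;
    repeat match goal with
    | H : _ + 1 = _ + 1 |- _ => apply (plus_cancel HM) in H
    | H : 1 = _ + 1 |- _ => apply Hs in H
    | H : _ + 1 = 1 |- _ => symmetry in H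
    | H : 0 = _ |- _ => symmetry in H
    end; try (now apply H0); try (now apply (H _ He)).
Qed.

Definition point (n : num M) (t : tag) (s : num M) : num M := pair M n (pair M (tag_code t) s).

Lemma point_inj n t s n' t' s' : point n t s = point n' t' s' -> n = n' /\ t = t' /\ s = s'.
Proof.
  intros H. apply (pair_inj HM) in H. destruct H as (Hn & H).
  apply (pair_inj HM) in H. destruct H as (Ht & Hs). apply tag_code_inj in Ht. auto.
Qed.

Lemma point_bounds n t s : n < point n t s + 1 /\ s < point n t s + 1.
Proof.
  split; [apply (pair_left_leq HM)|].
  apply (leq_trans HM (pair_right_leq HM (tag_code t) s)). apply (pair_right_leq HM).
Qed.

(** Quantification over tags is spelled out as a disjunction, which stays Delta0. *)
Definition some_tag (Q : tag -> Prop) : Prop := Q Guard \/ Q Left \/ Q Center \/ Q Right.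

Lemma some_tag_iff Q : some_tag Q <-> exists t, Q t.
Proof.
  unfold some_tag. split; [intros [H | [H | [H | H]]]; eauto|].
  intros ([] & H); auto.
Qed.

Lemma Delta0_some_tag (Q : tag -> (nat -> num M) -> Prop) :
  (forall t, Delta0 M (Q t)) -> Delta0 M (fun e => some_tag (fun t => Q t e)).
Proof. intros H. repeat apply Delta0_or; apply H. Qed.

Lemma Delta0_const (Q : Prop) : Delta0 M (fun _ => Q).
Proof.
  destruct (classic Q) as [H | H].
  - apply Delta0_ext with (P := fun _ => (0 : num M) = 0); [tauto | delta0].
  - apply Delta0_ext with (P := fun _ => (0 : num M) <> 0); [tauto | delta0].
Qed.

Lemma point_set (V : tag -> num M -> num M -> Prop) :
  (forall t, Delta0 M (fun e => V t (e O) (e 1%nat))) ->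
  exists X, (forall z, z \in X -> exists n t s, z = point n t s /\ V t n s) /\
    forall n t s, point n t s \in X <-> V t n s.
Proof.
  intros HV.
  destruct (@Delta0_comprehension _ HM (fun z => exists n, n < z + 1 /\ exists s, s < z + 1 /\
    some_tag (fun t => z = point n t s /\ V t n s))) as (X & HX).
  { apply Delta0_ex; [polynomial|]. apply Delta0_ex; [polynomial|].
    apply Delta0_some_tag with (Q := fun t e =>
      e 2%nat = point (e 1%nat) t (e O) /\ V t (e 1%nat) (e O)).
    intros t. apply Delta0_and; [unfold point; delta0|].
    apply (Delta0_at2 HM (V t)); [apply HV | polynomial..]. }
  exists X. split.
  - intros z Hz. apply HX in Hz. destruct Hz as (n & _ & s & _ & H).
    apply some_tag_iff in H. destruct H as (t & H). eauto.
  - intros n t s. rewrite HX. split.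
    + intros (n' & _ & s' & _ & H). apply some_tag_iff in H. destruct H as (t' & He & H).
      apply point_inj in He. now destruct He as (-> & -> & ->).
    + intros H. exists n. split; [apply point_bounds|]. exists s. split; [apply point_bounds|].
      apply some_tag_iff. eauto.
Qed.

Lemma point_relation (G : tag -> tag -> num M -> num M -> num M -> num M -> Prop) :
  (forall t t', Delta0 M (fun e => G t t' (e O) (e 1%nat) (e 2%nat) (e 3%nat))) ->
  exists X, (forall z, z \in X -> exists n t s n' t' s',
      z = pair M (point n t s) (point n' t' s') /\ G t t' n s n' s') /\
    forall n t s n' t' s', holds M X (point n t s) (point n' t' s') <-> G t t' n s n' s'.
Proof.
  intros HG.
  destruct (@Delta0_comprehension _ HM (fun z =>
    exists n, n < z + 1 /\ exists s, s < z + 1 /\ exists n', n' < z + 1 /\ exists s', s' < z + 1 /\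
    some_tag (fun t => some_tag (fun t' =>
      z = pair M (point n t s) (point n' t' s') /\ G t t' n s n' s')))) as (X & HX).
  { do 4 (apply Delta0_ex; [polynomial|]). cbv beta.
    apply Delta0_some_tag with (Q := fun t e => some_tag (fun t' =>
      e 4%nat = pair M (point (e 3%nat) t (e 2%nat)) (point (e 1%nat) t' (e O)) /\
      G t t' (e 3%nat) (e 2%nat) (e 1%nat) (e O))). intros t.
    apply Delta0_some_tag with (Q := fun t' e =>
      e 4%nat = pair M (point (e 3%nat) t (e 2%nat)) (point (e 1%nat) t' (e O)) /\
      G t t' (e 3%nat) (e 2%nat) (e 1%nat) (e O)). intros t'.
    apply Delta0_and; [unfold point; delta0|].
    apply (Delta0_rename (fun n => match n with O => 3 | 1 => 2 | 2 => 1 | _ => O end)%nat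
      (fun e n => e (match n with O => 3 | 1 => 2 | 2 => 1 | _ => O end)%nat) (HG t t')).
    reflexivity. }
  exists X. split.
  - intros z Hz. apply HX in Hz. destruct Hz as (n & _ & s & _ & n' & _ & s' & _ & H).
    apply some_tag_iff in H. destruct H as (t & H).
    apply some_tag_iff in H. destruct H as (t' & H). eauto 10.
  - intros n t s n' t' s'. unfold holds. rewrite HX. split.
    + intros (m & _ & r & _ & m' & _ & r' & _ & H).
      apply some_tag_iff in H. destruct H as (u & H).
      apply some_tag_iff in H. destruct H as (u' & He & H).
      apply (pair_inj HM) in He. destruct He as (He & He').
      apply point_inj in He, He'.
      now destruct He as (-> & -> & ->), He' as (-> & -> & ->).
    + intros H.
      destruct (point_bounds n t s) as (H1 & H2), (point_bounds n' t' s') as (H3 & H4).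
      pose proof (pair_left_leq HM (point n t s) (point n' t' s')) as H5.
      pose proof (pair_right_leq HM (point n t s) (point n' t' s')) as H6.
      exists n. split; [exact (leq_trans HM H1 H5)|].
      exists s. split; [exact (leq_trans HM H2 H5)|].
      exists n'. split; [exact (leq_trans HM H3 H6)|].
      exists s'. split; [exact (leq_trans HM H4 H6)|].
      apply some_tag_iff. exists t. apply some_tag_iff. eauto.
Qed.
End Gadget.

Ltac tag_delta0 :=
  cbv beta;
  lazymatch goal with
  | |- Delta0 _ (fun _ => ?Q) => apply Delta0_const
  | |- Delta0 _ (fun e => _ /\ _) => apply Delta0_and; tag_delta0
  | |- Delta0 _ (fun e => _ \/ _) => apply Delta0_or; tag_delta0
  | |- Delta0 _ (fun e => ~ _) => apply Delta0_not; tag_delta0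
  | |- _ => delta0
  end.

(** * The interval order built from two disjoint Sigma1 sets *)

Section Reversal.
Variable M : L2_structure.
Hypothesis HM : RCA0 M.
Variables A B : set M.
Hypothesis HAB : forall n s t, holds M A n s -> ~ holds M B n t.
Variable two_sided : bool.

Local Notation point := (point M).

Definition valid (t : tag) (n s : num M) : Prop :=
  match t with
  | Guard | Center => s = 0
  | Left => two_sided = true /\ (holds M A n s \/ holds M B n s)
  | Right => holds M A n s \/ holds M B n s
  end.

Definition point_less (t t' : tag) (n s n' s' : num M) : Prop :=
  n < n' \/ (n = n' /\ (tag_less t t' \/ (t = t' /\ s < s'))).

Definition point_leq (t t' : tag) (n s n' s' : num M) : Prop :=
  point_less t t' n s n' s' \/ (n = n' /\ t = t' /\ s = s').

(** The points (n, Guard, 0) and (n, Center, 0) are also the names of the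
    elements p_n and q_n of the interval order; the other points name
    themselves. *)
Definition covers (t t' : tag) (n s n' s' : num M) : Prop :=
  n = n' /\
  match t, t' with
  | (Guard | Center), Center => True
  | Guard, Guard => two_sided = false
  | Guard, (Left | Right) => holds M B n s'
  | Center, (Left | Right) => holds M A n s'
  | Left, Left | Right, Right => s = s'
  | _, _ => False
  end.

Definition precedes (t t' : tag) (n s n' s' : num M) : Prop :=
  n < n' \/ (n = n' /\
  match t, t' with
  | Left, Guard => ~ holds M B n s
  | Left, Center => ~ holds M A n s
  | Guard, Right => ~ holds M B n s'
  | Center, Right => ~ holds M A n s'
  | Left, Left | Right, Right => s < s'
  | Left, Right => True
  | _, _ => False
  end).

Lemma point_less_irrefl t n s : ~ point_less t t n s n s.
Proof.
  intros [H | (_ & [H | (_ & H)])]; try now apply (less_irrefl HM) in H.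
  now destruct t.
Qed.

Lemma point_less_trans t t' t'' n s n' s' n'' s'' :
  point_less t t' n s n' s' -> point_less t' t'' n' s' n'' s'' ->
  point_less t t'' n s n'' s''.
Proof.
  intros [H | (<- & H)] [H' | (<- & H')]; unfold point_less; auto.
  - left. exact (less_trans HM H H').
  - right. split; [easy|]. destruct H as [H | (<- & H)], H' as [H' | (<- & H')]; auto.
    + left. now destruct t, t', t''.
    + right. split; [easy|]. exact (less_trans HM H H').
Qed.

Lemma point_less_total t t' n s n' s' : point_leq t t' n s n' s' \/ point_less t' t n' s' n s.
Proof.
  unfold point_leq, point_less.
  destruct (less_trichotomy HM n n') as [H | [<- | H]]; auto.
  assert (Ht : tag_less t t' \/ t = t' \/ tag_less t' t) by (destruct t, t'; simpl; auto).
  destruct Ht as [H | [<- | H]]; auto 6.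
  destruct (less_trichotomy HM s s') as [H | [<- | H]]; auto 8.
Qed.

Lemma covers_representative t n s : valid t n s -> exists u r,
  valid u n r /\ covers t u n s n r /\
  match t with Guard | Center => u = Center /\ r = 0 | _ => u = t /\ r = s end.
Proof.
  intros H. unfold covers. destruct t; simpl in H.
  - now exists Center, 0.
  - now exists Left, s.
  - now exists Center, 0.
  - now exists Right, s.
Qed.

(** As n is never in both A and B, all Left and Right points of a block come from the same set, so
    the interval of p_n or q_n contains all of them or none. In the two-sided gadget the Guard is
    kept out of F(p_n): for n in A, uncovered Left points lie between it and the Center. *)
Lemma covers_convex t n s t1 n1 s1 t2 n2 s2 t3 n3 s3 :
  valid t n s -> valid t1 n1 s1 -> valid t2 n2 s2 -> valid t3 n3 s3 ->
  covers t t1 n s n1 s1 -> covers t t3 n s n3 s3 ->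
  point_leq t1 t2 n1 s1 n2 s2 -> point_leq t2 t3 n2 s2 n3 s3 -> covers t t2 n s n2 s2.
Proof.
  intros H H1 H2 H3 (<- & C1) (<- & C3) L12 L23.
  assert (He : n = n2).
  { destruct L12 as [[L12 | (He & _)] | (He & _)]; auto.
    destruct L23 as [[L23 | (He & _)] | (He & _)]; auto.
    exfalso. exact (less_irrefl HM (less_trans HM L12 L23)). }
  subst n2. split; [easy|].
  assert (L12' : tag_less t1 t2 \/ (t1 = t2 /\ (s1 < s2 \/ s1 = s2))).
  { destruct L12 as [[L12 | (_ & [L12 | (Ht & L12)])] | (_ & Ht & L12)]; auto.
    now apply (less_irrefl HM) in L12. }
  assert (L23' : tag_less t2 t3 \/ (t2 = t3 /\ (s2 < s3 \/ s2 = s3))).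
  { destruct L23 as [[L23 | (_ & [L23 | (Ht & L23)])] | (_ & Ht & L23)]; auto.
    now apply (less_irrefl HM) in L23. }
  clear L12 L23.
  assert (HA2 : forall s', holds M A n s' -> holds M A n s2 \/ holds M B n s2 -> holds M A n s2).
  { intros s' Hs' [Hs2 | Hs2]; [easy|]. exfalso; exact (HAB n s' s2 Hs' Hs2). }
  assert (HB2 : forall s', holds M B n s' -> holds M A n s2 \/ holds M B n s2 -> holds M B n s2).
  { intros s' Hs' [Hs2 | Hs2]; [|easy]. exfalso; exact (HAB n s2 s' Hs2 Hs'). }
  assert (Hlt : s1 < s2 \/ s1 = s2 -> s2 < s3 \/ s2 = s3 -> s1 = s3 -> s1 = s2).
  { intros [Hl | Hl] [Hr | Hr] He; subst; auto; exfalso.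
    exact (less_irrefl HM (less_trans HM Hl Hr)). }
  destruct t, t1; simpl in C1; try contradiction; destruct t3; simpl in C3;
    try contradiction; destruct t2; simpl in L12', L23' |- *;
    try destruct L12' as [[] | [E1 L12']]; try destruct L23' as [[] | [E2 L23']];
    try discriminate; try exact I; try assumption.
  all: simpl in H1, H2, H3.
  all: first
    [ exfalso; destruct H2; congruence
    | apply HB2 with s1; [assumption | now apply H2]
    | apply HB2 with s3; [assumption | now apply H2]
    | apply HA2 with s1; [assumption | now apply H2]
    | apply HA2 with s3; [assumption | now apply H2]
    | rewrite C1; apply Hlt; congruence ].
Qed.

Definition names_itself (t : tag) : Prop :=
  match t with Left | Right => True | _ => False end.

Lemma precedes_iff t n s t' n' s' : valid t n s -> valid t' n' s' ->
  (precedes t t' n s n' s' <-> forall u m r u' m' r', valid u m r -> valid u' m' r' ->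
     covers t u n s m r -> covers t' u' n' s' m' r' -> point_less u u' m r m' r').
Proof.
  intros H H'. split.
  - intros [Hl | (<- & Hp)] u m r u' m' r' V V' (<- & C) (<- & C'); [now left|].
    right. split; [easy|].
    destruct t, t'; try contradiction; destruct u, u'; simpl in *; try contradiction;
      try (left; exact I); try (right; split; [easy|]; congruence); exfalso;
      first
        [ apply Hp; congruence
        | destruct H; congruence
        | destruct H' as [H' | H']; (contradiction || (eapply HAB; eassumption))
        | destruct H as [_ [H | H]]; (contradiction || (eapply HAB; eassumption)) ].
  - intros Hall.
    destruct (@covers_representative t n s H) as (u & r & V & C & E),
      (@covers_representative t' n' s' H') as (u' & r' & V' & C' & E').
    pose proof (Hall u n r u' n' r' V V' C C') as H0.
    (* A Left or Right element has a single point as its interval; if the other interval contained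
       that point too, the point would precede itself. The order of the representatives settles
       everything else. *)
    assert (Hy : names_itself t' -> ~ covers t t' n s n' s').
    { intros Ht HC. apply (@point_less_irrefl t' n' s'). apply Hall; auto.
      split; [easy|]. now destruct t'. }
    assert (Hx : names_itself t -> ~ covers t' t n' s' n s).
    { intros Ht HC. apply (@point_less_irrefl t n s). apply Hall; auto.
      split; [easy|]. now destruct t. }
    clear Hall C C' V V'. destruct H0 as [Hl | (<- & H0)]; [now left|].
    right. split; [easy|].
    destruct t, t'; simpl in *; destruct E as (-> & ->), E' as (-> & ->);
      try exact I;
      try (intros HC; first [apply (Hx I) | apply (Hy I)]; now split);
      destruct H0 as [[] | [He H0]]; try discriminate; try assumption;
      now apply (less_irrefl HM) in H0.
Qed.

(** The elements of the order serve as the points of the line as well; in the two-sided case a Guard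
    is a point that lies in no interval. *)
Lemma gadget : exists P R RL F, partial_order M P R /\ interval_rep M P R P RL F /\
  (forall n t s, point n t s \in P <-> valid t n s) /\
  (forall z, z \in P -> exists n t s, z = point n t s) /\
  (forall t n s t' n' s', valid t n s -> valid t' n' s' ->
     (strict M R (point n t s) (point n' t' s') <-> precedes t t' n s n' s')) /\
  (forall n t s n' t' s', holds M F (point n t s) (point n' t' s') <->
     valid t n s /\ valid t' n' s' /\ covers t t' n s n' s').
Proof.
  destruct (@point_set M HM valid) as (P & HPz & HP).
  { intros []; unfold valid; tag_delta0. }
  destruct (@point_relation M HM (fun t t' n s n' s' => valid t n s /\ valid t' n' s' /\
    point_leq t t' n s n' s')) as (RL & HRLz & HRL).
  { intros [] []; unfold valid, point_leq, point_less; simpl; tag_delta0. }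
  destruct (@point_relation M HM (fun t t' n s n' s' => valid t n s /\ valid t' n' s' /\
    covers t t' n s n' s')) as (F & HFz & HF).
  { intros [] []; unfold valid, covers; simpl; tag_delta0. }
  destruct (@point_relation M HM (fun t t' n s n' s' => valid t n s /\ valid t' n' s' /\
    ((n = n' /\ t = t' /\ s = s') \/ precedes t t' n s n' s'))) as (R & HRz & HR).
  { intros [] []; unfold valid, precedes; simpl; tag_delta0. }
  assert (HL : linear_order M P RL).
  { split; [split|].
    - intros z Hz. destruct (HRLz z Hz) as (n & t & s & n' & t' & s' & -> & V & V' & _).
      exists (point n t s), (point n' t' s'). rewrite !HP. auto.
    - intros z Hz. destruct (HPz z Hz) as (n & t & s & -> & V). apply HRL. unfold point_leq. auto 8.
    - intros x y z Hx Hy Hz.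
      destruct (HPz x Hx) as (n & t & s & -> & V), (HPz y Hy) as (n' & t' & s' & -> & V'),
        (HPz z Hz) as (n'' & t'' & s'' & -> & V'').
      rewrite !HRL. intros (_ & _ & [H | (<- & <- & <-)]) (_ & _ & [H' | (<- & <- & <-)]);
        (split; [easy|]); (split; [easy|]); unfold point_leq; auto 8.
      left. eapply point_less_trans; eassumption.
    - intros x y Hx Hy.
      destruct (HPz x Hx) as (n & t & s & -> & V), (HPz y Hy) as (n' & t' & s' & -> & V').
      rewrite !HRL. intros (_ & _ & [H | (<- & <- & <-)]) (_ & _ & H'); auto.
      destruct H' as [H' | (<- & <- & <-)]; auto.
      exfalso. exact (point_less_irrefl (point_less_trans H H')).
    - intros x y Hx Hy.
      destruct (HPz x Hx) as (n & t & s & -> & V), (HPz y Hy) as (n' & t' & s' & -> & V').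
      rewrite !HRL. destruct (point_less_total t t' n s n' s') as [H | H]; auto.
      right. unfold point_leq. auto 8. }
  assert (HRLs : forall t n s t' n' s', valid t n s -> valid t' n' s' ->
    (strict M RL (point n t s) (point n' t' s') <-> point_less t t' n s n' s')).
  { intros t n s t' n' s' V V'. unfold strict. rewrite HRL. split.
    - intros ((_ & _ & [H | (<- & <- & <-)]) & Hne); [easy|]. now contradiction Hne.
    - intros H. split; [unfold point_leq; auto|].
      intros He. apply (point_inj HM) in He. destruct He as (-> & -> & ->).
      now apply point_less_irrefl in H. }
  assert (HRs : forall t n s t' n' s', valid t n s -> valid t' n' s' ->
    (strict M R (point n t s) (point n' t' s') <-> precedes t t' n s n' s')).
  { intros t n s t' n' s' V V'. unfold strict. rewrite HR. split.
    - intros ((_ & _ & [(<- & <- & <-) | H]) & Hne); [now contradiction Hne | easy].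
    - intros H. split; [auto|].
      intros He. apply (point_inj HM) in He. destruct He as (-> & -> & ->).
      destruct H as [H | (_ & H)]; [now apply (less_irrefl HM) in H|].
      destruct t'; try easy; now apply (less_irrefl HM) in H. }
  assert (Hrep : interval_rep M P R P RL F).
  { split; [easy|..].
    - intros z Hz. destruct (HFz z Hz) as (n & t & s & n' & t' & s' & -> & V & V' & _).
      exists (point n t s), (point n' t' s'). rewrite !HP. auto.
    - intros p Hp. destruct (HPz p Hp) as (n & t & s & -> & V).
      destruct (@covers_representative t n s V) as (t' & s' & V' & C & _).
      exists (point n t' s'). apply HF. auto.
    - intros p x y z Hp Hx Hy Hz.
      destruct (HPz p Hp) as (n & t & s & -> & V), (HPz x Hx) as (n1 & t1 & s1 & -> & V1),
        (HPz y Hy) as (n2 & t2 & s2 & -> & V2), (HPz z Hz) as (n3 & t3 & s3 & -> & V3).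
      rewrite !HF, !HRL. intros (_ & _ & C1) (_ & _ & C3) (_ & _ & L12) (_ & _ & L23).
      split; [easy|]. split; [easy|].
      exact (covers_convex V V1 V2 V3 C1 C3 L12 L23).
    - intros p q Hp Hq.
      destruct (HPz p Hp) as (n & t & s & -> & V), (HPz q Hq) as (n' & t' & s' & -> & V').
      rewrite (HRs _ _ _ _ _ _ V V'), (precedes_iff t n s t' n' s' V V'). split.
      + intros H x y Hx Hy.
        destruct (HFz _ Hx) as (m0 & u0 & r0 & m & u & r & E & _).
        apply (pair_inj HM) in E. destruct E as (_ & ->).
        destruct (HFz _ Hy) as (m1 & u1 & r1 & m' & u' & r' & E & _).
        apply (pair_inj HM) in E. destruct E as (_ & ->).
        apply HF in Hx, Hy. destruct Hx as (_ & Vx & Cx), Hy as (_ & Vy & Cy).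
        apply HRLs; auto.
      + intros H u m r u' m' r' Vu Vu' C C'. apply HRLs; auto.
        apply H; apply HF; auto. }
  exists P, R, RL, F. split; [|split; [easy|]].
  - destruct Hrep as [_ Hsub Hne _ Hord].
    apply (partial_order_of_intervals HL F); auto.
    + intros z Hz. destruct (HRz z Hz) as (n & t & s & n' & t' & s' & -> & V & V' & _).
      exists (point n t s), (point n' t' s'). rewrite !HP. auto.
    + intros p Hp. destruct (HPz p Hp) as (n & t & s & -> & V). apply HR. auto 8.
    + intros p x Hx. apply (subset_prod_holds HM Hsub Hx).
  - split; [exact HP|]. split; [|split; [exact HRs | exact HF]].
    intros z Hz. destruct (HPz z Hz) as (n & t & s & H & _). eauto.
Qed.

End Reversal.

(** Since a < q fails, F(q) has a point not above some point of F(a); since q < b fails, it has one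
    not below some point of F(b). F(p) lies strictly between F(a) and F(b), so convexity of F(q)
    gives the inclusion. *)
Lemma interval_rep_covers (M : L2_structure) (HM : RCA0 M) P R L RL F :
  interval_rep M P R L RL F ->
  forall p q a b, p \in P -> q \in P -> a \in P -> b \in P ->
  strict M R a p -> strict M R p b -> ~ strict M R a q -> ~ strict M R q b ->
  forall x, holds M F p x -> holds M F q x.
Proof.
  intros Hrep p q a b Hp Hq Ha Hb Hap Hpb Haq Hqb x Hx.
  pose proof Hrep as [HL Hsub _ Hconv Hord].
  assert (HFL : forall p x, holds M F p x -> x \in L).
  { intros p' x' Hx'. apply (subset_prod_holds HM Hsub Hx'). }
  destruct (interval_rep_not_strict HM Hrep Ha Hq Haq) as (u & v & Hu & Hv & Hvu).
  destruct (interval_rep_not_strict HM Hrep Hq Hb Hqb) as (v' & u' & Hv' & Hu' & Hvu').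
  assert (Hux : strict M RL u x) by (apply (proj1 (Hord a p Ha Hp)); auto).
  assert (Hxu : strict M RL x u') by (apply (proj1 (Hord p b Hp Hb)); auto).
  apply Hconv with (x := v) (z := v'); eauto.
  - apply (po_trans (proj1 HL)) with u; eauto. apply Hux.
  - apply (po_trans (proj1 HL)) with u'; eauto. apply Hxu.
Qed.

Lemma one_one_separation (M : L2_structure) (HM : RCA0 M) :
  (forall P R : set M, interval_order M P R -> one_one_interval_order M P R) ->
  separation M.
Proof.
  intros H11 A B HAB.
  destruct (gadget HM A B HAB true) as (P & R & RL0 & F0 & Hpo & Hrep0 & HP & _ & HR & _).
  destruct (H11 P R) as (_ & L & RL & F & Hrep & Hinj).
  { split; [easy|]. now exists P, RL0, F0. }
  set (p := fun n => point M n Guard 0). set (q := fun n => point M n Center 0).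
  assert (Hp : forall n, p n \in P) by (intros n; now apply HP).
  assert (Hq : forall n, q n \in P) by (intros n; now apply HP).
  assert (HA : forall n s x, holds M A n s -> holds M F (p n) x -> holds M F (q n) x).
  { intros n s x Hs.
    assert (HB : ~ holds M B n s) by now apply (HAB n s s).
    apply (interval_rep_covers HM Hrep (a := point M n Left s) (b := point M n Right s));
      auto; try (apply HP; simpl; auto);
      unfold p, q; rewrite HR by (simpl; auto); unfold precedes; simpl; try (now right);
      intros [H | (_ & H)]; auto; now apply (less_irrefl HM) in H. }
  assert (HB : forall n s x, holds M B n s -> holds M F (q n) x -> holds M F (p n) x).
  { intros n s x Hs.
    assert (HA' : ~ holds M A n s) by (intros H; now apply (HAB n s s)).
    apply (interval_rep_covers HM Hrep (a := point M n Left s) (b := point M n Right s));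
      auto; try (apply HP; simpl; auto);
      unfold p, q; rewrite HR by (simpl; auto); unfold precedes; simpl; try (now right);
      intros [H | (_ & H)]; auto; now apply (less_irrefl HM) in H. }
  destruct (decide HM (fun x n => holds M F (q n) x /\ ~ holds M F (p n) x)
    (fun x n => holds M F (p n) x /\ ~ holds M F (q n) x)) as (X & HX).
  - delta0.
  - delta0.
  (* The search ends for every n, also for those outside A and B, where either answer is correct. *)
  - intros n. apply NNPP. intros HN. apply (Hinj (p n) (q n)); auto.
    + intros He. apply (point_inj HM) in He. destruct He as (_ & He & _). discriminate.
    + intros x. split; intros Hx; apply NNPP; intros Hx'; apply HN; exists x; auto.
  - exists X. intros n s. destruct (HX n) as (H1 & H2). split.
    + intros Hs. apply NNPP. intros Hn. destruct (H2 Hn) as (x & Hx & Hx').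
      apply Hx'. now apply (HA n s).
    + intros Hs Hn. destruct (H1 Hn) as (x & Hx & Hx'). apply Hx'. now apply (HB n s).
Qed.

Lemma closed_separation (M : L2_structure) (HM : RCA0 M) :
  (forall P R : set M, one_one_interval_order M P R -> closed_interval_order M P R) ->
  separation M.
Proof.
  intros H11 A B HAB.
  destruct (gadget HM A B HAB false) as (P & R & RL0 & F0 & Hpo & Hrep0 & HP & HPz & HR & HF0).
  destruct (H11 P R) as (_ & L & RL & f0 & f1 & [HL Hf0 Hf1 _ Hord]).
  { split; [easy|]. exists P, RL0, F0. split; [easy|].
    intros x y Hx Hy Hne Heq.
    destruct (HPz x Hx) as (n & t & s & ->), (HPz y Hy) as (n' & t' & s' & ->).
    apply HP in Hx, Hy. apply Hne.
    (* In the one-sided gadget every interval contains the point that names it, so elements with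
       equal intervals would cover each other's names; F(p_n) contains the Center, but F(q_n) omits
       the Guard. *)
    assert (Hself : forall t n s, covers M A B false t t n s n s)
      by (intros [] ? ?; now split).
    assert (Hxy : holds M F0 (point M n t s) (point M n' t' s')).
    { apply Heq, HF0. auto. }
    assert (Hyx : holds M F0 (point M n' t' s') (point M n t s)).
    { apply Heq, HF0. auto. }
    apply HF0 in Hxy, Hyx. destruct Hxy as (_ & _ & <- & Hxy), Hyx as (_ & _ & _ & Hyx).
    destruct t, t'; simpl in Hx, Hy, Hxy, Hyx; try contradiction; congruence. }
  set (p := fun n => point M n Guard 0). set (q := fun n => point M n Center 0).
  assert (Hp : forall n, p n \in P) by (intros n; now apply HP).
  assert (Hq : forall n, q n \in P) by (intros n; now apply HP).
  destruct Hf0 as (Hs0 & Ht0 & _), Hf1 as (Hs1 & Ht1 & Hu1).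
  assert (HL0 : forall p x, holds M f0 p x -> x \in L).
  { intros p' x Hx. apply (subset_prod_holds HM Hs0 Hx). }
  assert (HL1 : forall p x, holds M f1 p x -> x \in L).
  { intros p' x Hx. apply (subset_prod_holds HM Hs1 Hx). }
  (* The left endpoint of r separates the two right endpoints: f1(p) < f0(r) <= f1(q). *)
  assert (Hlt : forall p q r b c, p \in P -> q \in P -> r \in P -> strict M R p r ->
    ~ strict M R q r -> holds M f1 p b -> holds M f1 q c -> strict M RL b c).
  { intros p' q' r b c Hp' Hq' Hr Hpr Hqr Hb Hc.
    destruct (Ht0 r Hr) as (a & Ha).
    apply (strict_leq_trans HL) with a; eauto.
    - now apply (Hord p' r b a).
    - apply (linear_not_strict HL); eauto. intros H. apply Hqr. now apply (Hord q' r c a). }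
  (* The function f1 is given only by its graph, so its values at p_n and q_n are searched for; x
     codes the pair of them, and their comparison is then decidable. *)
  destruct (decide HM
    (fun x n => exists b, b < x + 1 /\ exists c, c < x + 1 /\ (x = pair M b c /\
       holds M f1 (p n) b /\ holds M f1 (q n) c /\ strict M RL b c))
    (fun x n => exists b, b < x + 1 /\ exists c, c < x + 1 /\ (x = pair M b c /\
       holds M f1 (p n) b /\ holds M f1 (q n) c /\ ~ strict M RL b c))) as (X & HX).
  - unfold p, q. delta0.
  - unfold p, q. delta0.
  - intros n. destruct (Ht1 (p n) (Hp n)) as (b & Hb), (Ht1 (q n) (Hq n)) as (c & Hc).
    exists (pair M b c). pose proof (pair_left_leq HM b c). pose proof (pair_right_leq HM b c).
    destruct (classic (strict M RL b c)) as [Hbc | Hbc]; [left | right];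
      exists b; (split; [easy|]); exists c; auto.
  - assert (HR' : forall n s, holds M A n s \/ holds M B n s -> point M n Right s \in P)
      by (intros; now apply HP).
    assert (HRp : forall n s, holds M A n s \/ holds M B n s ->
      (strict M R (p n) (point M n Right s) <-> ~ holds M B n s)).
    { intros n s Hs. unfold p. rewrite HR by (simpl; auto). unfold precedes. split; [|auto].
      intros [H | (_ & H)]; [now apply (less_irrefl HM) in H | easy]. }
    assert (HRq : forall n s, holds M A n s \/ holds M B n s ->
      (strict M R (q n) (point M n Right s) <-> ~ holds M A n s)).
    { intros n s Hs. unfold q. rewrite HR by (simpl; auto). unfold precedes. split; [|auto].
      intros [H | (_ & H)]; [now apply (less_irrefl HM) in H | easy]. }
    exists X. intros n s. destruct (HX n) as (H1 & H2). split.
    + intros Hs. apply NNPP. intros Hn.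
      destruct (H2 Hn) as (_ & b & _ & c & _ & _ & Hb & Hc & Hbc). apply Hbc.
      apply (Hlt (p n) (q n) (point M n Right s)); auto.
      * apply HRp; auto. exact (HAB n s s Hs).
      * rewrite HRq; auto.
    + intros Hs Hn.
      destruct (H1 Hn) as (_ & b & _ & c & _ & _ & Hb & Hc & Hbc).
      apply (@strict_irrefl M RL b).
      apply (strict_leq_trans HL) with c; eauto.
      apply (Hlt (q n) (p n) (point M n Right s)); auto.
      * apply HRq; auto. intros H. exact (HAB n s s H Hs).
      * rewrite HRp; auto.
Qed.

Theorem theorem5p6 (M : L2_structure) (HM : RCA0 M) :
  (WKL0 M <->
   forall P R : set M,
     partial_order M P R -> no_2plus2 M P R -> one_one_interval_order M P R) /\
  (WKL0 M <->
   forall P R : set M,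
     interval_order M P R -> one_one_interval_order M P R) /\
  (WKL0 M <->
   forall P R : set M,
     one_one_interval_order M P R -> distinguishing_interval_order M P R) /\
  (WKL0 M <->
   forall P R : set M,
     one_one_interval_order M P R -> closed_interval_order M P R).
Proof.
  assert (H11 : forall P R, one_one_interval_order M P R -> interval_order M P R).
  { intros P R (HP & L & RL & F & H & _). split; [easy|]. now exists L, RL, F. }
  assert (Hdc : forall P R, distinguishing_interval_order M P R -> closed_interval_order M P R).
  { intros P R (HP & L & RL & f0 & f1 & H & _). split; [easy|]. now exists L, RL, f0, f1. }
  (* Statements (iii) and (v) each yield weak König's lemma; (ii) implies (iii) because interval
     orders omit 2 + 2, and (iv) implies (v) by forgetting that endpoints differ. *)
  assert (Hiii : (forall P R : set M, interval_order M P R -> one_one_interval_order M P R) ->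
    WKL0 M).
  { intros H. split; [exact HM|]. now apply (separation_WKL HM), (one_one_separation HM). }
  assert (Hv : (forall P R : set M, one_one_interval_order M P R ->
    closed_interval_order M P R) -> WKL0 M).
  { intros H. split; [exact HM|]. now apply (separation_WKL HM), (closed_separation HM). }
  split; [|split; [|split]]; split.
  - intros (_ & HW) P R HP H22. now apply (WKL_one_one HM).
  - intros H. apply Hiii. intros P R HPR. apply H; [apply HPR|].
    now apply (interval_order_no_2plus2 HM).
  - intros (_ & HW) P R HPR. apply (WKL_one_one HM); [apply HPR | | easy].
    now apply (interval_order_no_2plus2 HM).
  - exact Hiii.
  - intros (_ & HW) P R HPR. apply (WKL_distinguishing HM); [apply HPR | | easy].
    apply (interval_order_no_2plus2 HM). auto.
  - intros H. apply Hv. auto.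
  - intros (_ & HW) P R HPR. apply Hdc, (WKL_distinguishing HM); [apply HPR | | easy].
    apply (interval_order_no_2plus2 HM). auto.
  - exact Hv.
Qed.
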